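(* Let $B_1\subset\mathbb{R}^2$ be the open unit disk. For $a,b\in W^{1,2}(B_1)$ let $\varphi=\varphi_{a,b}\in W^{1,2}_0(B_1)$ denote the unique (weak) solution of $$\begin{cases}\Delta\varphi=\nabla a\cdot\nabla^\perp b & \text{on } B_1,\\ \varphi=0 & \text{on }\partial B_1.\end{cases}$$ Then for every real $\beta<1$, $$\sup_{a,b}\ \frac{\big\|\,|x|\,\nabla\varphi_{a,b}\big\|_{L^2(B_1)}}{\|\nabla a\|_{L^2(B_1)}\,\big\|\,|x|\,|\log|x||^{\beta/2}\,\nabla b\big\|_{L^2(B_1)}}=\infty,$$ where the supremum is over all $a,b\in W^{1,2}(B_1)$ for which the denominator is nonzero and finite.
   Context: For a function $b$ of $(x_1,x_2)\in\mathbb{R}^2$, $\nabla^\perp b=(\partial_{x_2}b,-\partial_{x_1}b)$, so that $\nabla a\cdot\nabla^\perp b=\partial_{x_1}a\,\partial_{x_2}b-\partial_{x_2}a\,\partial_{x_1}b\in L^1(B_1)$ is a Jacobian determinant. By Wente's classical theorem, for $a,b\in W^{1,2}(B_1)$ the Dirichlet problem has a unique solution in $W^{1,2}_0(B_1)$ (in the sense of distributions). *)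

(* Defs.v *)
From HB Require Import structures.
From mathcomp Require Import all_boot all_order all_algebra.
From mathcomp Require Import all_classical all_reals all_analysis.
Set Implicit Arguments.
Unset Strict Implicit.
Unset Printing Implicit Defensive.
Import Order.TTheory GRing.Theory Num.Theory.
Import numFieldNormedType.Exports.
Local Open Scope classical_set_scope.
Local Open Scope ring_scope.

(* The plane is R * R.  Its library norm is the max norm (same topology as the
   Euclidean one), hence the explicit Euclidean norm below. *)

Section Plane.
Context {R : realType}.

Definition dot (u v : R * R) : R := u.1 * v.1 + u.2 * v.2.
Definition enorm (u : R * R) : R := Num.sqrt (dot u u).

(* If g is the gradient of b then perp g is (d_2 b, - d_1 b). *)
Definition perp (g : R * R) : R * R := (g.2, - g.1).

Definition disk : set (R * R) := [set x | enorm x < 1].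

Definition leb2 :
    {measure set (measurableTypeR R * measurableTypeR R) -> \bar R} :=
  (@lebesgue_measure R \x @lebesgue_measure R)%E.

(* The classical gradient, used for smooth functions only. *)
Definition grad (f : R * R -> R) (x : R * R) : R * R :=
  ('D_((1, 0) : R * R) f x, 'D_((0, 1) : R * R) f x).

(* Continuity of f itself at level k+1 follows from that of its partials. *)
Fixpoint Ck (k : nat) (f : R * R -> R) : Prop :=
  if k is k'.+1 then
    [/\ forall x, derivable f x (1, 0), forall x, derivable f x (0, 1),
        Ck k' (fun x => (grad f x).1) & Ck k' (fun x => (grad f x).2)]
  else continuous f.

(* C_c^oo(B_1) *)
Definition test_function (eta : R * R -> R) : Prop :=
  [/\ forall k, Ck k eta,
      compact (closure [set x | eta x != 0])
    & closure [set x | eta x != 0] `<=` disk].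

(* Functions on B_1 are represented by total functions whose values outside
   B_1 are ignored; measurability is with respect to the Borel sets. *)
Definition L2norm (f : R * R -> R) : \bar R :=
  ('N[leb2]_(2%:E)[EFin \o (f \_ disk)])%E.

Definition L2 (f : R * R -> R) : Prop :=
  measurable_fun disk f /\ (L2norm f < +oo)%E.

(* || |G| ||_{L^2(B_1)}, with weight w. *)
Definition L2wnorm (w : R * R -> R) (G : R * R -> R * R) : \bar R :=
  L2norm (fun x => w x * enorm (G x)).

Definition weak_gradient (f : R * R -> R) (G : R * R -> R * R) : Prop :=
  forall eta, test_function eta ->
    (\int[leb2]_(x in disk) (f x * (grad eta x).1)) =
      - (\int[leb2]_(x in disk) ((G x).1 * eta x)) /\
    (\int[leb2]_(x in disk) (f x * (grad eta x).2)) =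
      - (\int[leb2]_(x in disk) ((G x).2 * eta x)).

(* f belongs to W^{1,2}(B_1) and G represents its weak gradient, which is
   unique up to a null set. *)
Definition W12 (f : R * R -> R) (G : R * R -> R * R) : Prop :=
  [/\ L2 f, L2 (fun x => (G x).1), L2 (fun x => (G x).2) & weak_gradient f G].

(* W^{1,2}_0(B_1) is the closure of C_c^oo(B_1) in W^{1,2}(B_1). *)
Definition W12_0 (f : R * R -> R) (G : R * R -> R * R) : Prop :=
  W12 f G /\
  exists eta : nat -> R * R -> R,
    [/\ forall n, test_function (eta n),
        L2norm (fun x => eta n x - f x) @[n --> \oo] --> 0%E
      & L2norm (fun x => enorm (grad (eta n) x - G x)) @[n --> \oo] --> 0%E].

(* phi in W^{1,2}_0(B_1), with weak gradient G, solves Laplacian phi = h in the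
   sense of distributions on B_1. *)
Definition dirichlet_solution (h : R * R -> R)
    (phi : R * R -> R) (G : R * R -> R * R) : Prop :=
  W12_0 phi G /\
  forall eta, test_function eta ->
    - (\int[leb2]_(x in disk) dot (G x) (grad eta x)) =
      \int[leb2]_(x in disk) (h x * eta x).

Definition the_dirichlet_solution (h : R * R -> R)
    (phi : R * R -> R) (G : R * R -> R * R) : Prop :=
  dirichlet_solution h phi G /\
  forall psi H, dirichlet_solution h psi H ->
    psi = phi %[ae leb2 in disk].

Definition jacobian_det (Ga Gb : R * R -> R * R) (x : R * R) : R :=
  dot (Ga x) (perp (Gb x)).

(* |x| |log |x||^(beta / 2); the junk value at x = 0 is irrelevant. *)
Definition log_weight (beta : R) (x : R * R) : R :=
  enorm x * `|ln (enorm x)| `^ (beta / 2).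

End Plane.

(* Main.v *)
Require Import Defs.
From mathcomp Require Import all_boot all_order all_algebra.
From mathcomp Require Import all_classical all_reals all_analysis.
From mathcomp Require Import measurable_realfun.
From mathcomp Require Import ring lra.
Set Implicit Arguments.
Unset Strict Implicit.
Unset Printing Implicit Defensive.
Import Order.TTheory GRing.Theory Num.Theory.
Import numFieldNormedType.Exports.
Local Open Scope classical_set_scope.
Local Open Scope ring_scope.

(** The weight |x| is scale critical up to a logarithm, and the quotient is
    tested on data a, b concentrated at the scale rho = 2^-n around the origin.
    Outside |x| = rho the solution then looks like a dipole p.x / |x|^2, so
    that |x|^2 |grad phi|^2 is comparable to |p|^2 / |x|^2, and its integral
    over rho < |x| < 1 collects a factor log (1 / rho), that is, n: one fixed
    contribution from each dyadic scale between rho and 1.  In the denominator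
    the energy of a is scale invariant, and the weight |x|^2 |log |x||^beta on
    the support of b is at most rho^2 n^max(beta, 0).  With b normalised so
    that p stays fixed, the square of the quotient is at least
    c n / n^max(beta, 0), which is unbounded as soon as beta < 1.

    The concentrated solutions are explicit.  Put L = 4^n, S = L |x|^2, and let
    g be a smooth function on the line with g t = 1 / t for t >= 1.  Then
        phi = (L g(S) - 1) x_1
    equals (1 / |x|^2 - 1) x_1 for |x| >= rho; it is harmonic there and vanishes
    on the unit circle.  Its Laplacian is 2 L^2 x_1 K(S) with
    K(t) = 2 t g''(t) + 4 g'(t) supported in [0, 1].  For a radial a = A(S) and
    b = - L K(S) x_2 the Jacobian determinant is - 2 L^2 A'(S) K(S) x_1, because
    the tangential derivative of b only sees the factor x_2.  So any A with
    A' = -1 on [0, 1] and constant on [2, oo[ makes phi the solution for the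
    pair (a, b) ([jacobian_wente], [wente_phi_weak]).

    That phi is the solution in the sense of distributions rests on three
    facts.  Integration by parts against a test function ([Rintegral_derive1],
    [integration_by_parts_disk]) is Fubini and the fundamental theorem of
    calculus on lines.  The function phi lies in W^{1,2}_0 because it is smooth
    and bounded by a multiple of 1 - |x|^2, so that multiplying it by cutoffs
    perturbs its gradient by a bounded quantity tending to 0 pointwise
    ([smooth2_W12_0]).  Uniqueness ([dirichlet_unique]) is the energy
    argument: the difference of two solutions is orthogonal to the gradients of
    the test functions approximating it, and the Poincare inequality
    ([poincare]) concludes.  The two sides of the quotient are estimated in
    [energy_grad_phi], [energy_grad_a] and [energy_grad_b]. *)

(** * Directional derivatives and flat functions *)

Section Calculus.
Context {R : realType}.
Implicit Types (f : R -> R) (u : R) (m : nat).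

(** Settles differentiability at junction points of piecewise formulas, where
    a one-sided computation would otherwise be needed on each side. *)
Lemma is_derive_quadratic f (x l C : R) :
  (forall h, `|f (x + h) - f x - l * h| <= C * h ^+ 2) -> is_derive x 1 f l.
Proof.
move=> fC.
have cl : (fun h : R => h^-1 *: (f (h *: (1 : R) + x) - f x)) @ 0^' --> l.
  apply/cvgrPdist_le => e e0.
  have C0 : 0 < `|C| + 1 by rewrite ltr_pwDr.
  near=> h.
  have h0 : h != 0 by near: h; exact: nbhs_dnbhs_neq.
  have -> : l - h^-1 *: (f (h *: (1 : R) + x) - f x) =
      - (h^-1 * (f (x + h) - f x - l * h)).
    rewrite /GRing.scale/= mulr1 (addrC h x); field => //.
  rewrite normrN normrM normfV.
  rewrite mulrC ler_pdivrMr ?normr_gt0//.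
  apply: (le_trans (fC h)).
  apply: (@le_trans _ _ ((`|C| + 1) * `|h| ^+ 2)).
    rewrite real_normK ?num_real// ler_wpM2r ?sqr_ge0//.
    by apply: (le_trans (ler_norm C)); lra.
  rewrite expr2 mulrA ler_wpM2r// -ler_pdivlMl//.
  near: h; apply: dnbhs0_le; by rewrite mulr_gt0 ?invr_gt0.
split; last exact: (cvg_lim _ cl).
by apply/cvg_ex; exists l.
Unshelve. all: by end_near. Qed.

(** A directional derivative is a one-variable derivative along a line; this is
    how the one-variable chain rule and the fundamental theorem of calculus
    reach functions of two variables. *)
Lemma is_derive_dir {V : normedModType R} (f : V -> R) (x v : V) (l : R) :
  is_derive x v f l <-> is_derive (0 : R) (1 : R) (fun h : R => f (h *: v + x)) l.
Proof.
have E : (fun h : R => h^-1 *: ((f \o shift x) (h *: v) - f x)) =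
  (fun h : R => h^-1 *: (((fun h : R => f (h *: v + x)) \o shift 0) (h *: (1 : R))
     - f ((0 : R) *: v + x))).
  apply/funext => h /=; have -> : h *: (1 : R) = h := mulr1 h.
  by rewrite addr0 scale0r add0r.
split=> -[D1 D2]; split.
- by move: D1; rewrite /derivable E.
- by rewrite -D2 /derive E.
- by move: D1; rewrite /derivable E.
- by rewrite -D2 /derive E.
Qed.

Lemma is_derive_comp_dir {V : normedModType R} (u : R -> R) (f : V -> R)
    (x v : V) (a b : R) :
  is_derive (f x) 1 u a -> is_derive x v f b ->
  is_derive x v (fun y => u (f y)) (a * b).
Proof.
move=> ua /is_derive_dir fb; apply/is_derive_dir.
apply: (@is_derive1_comp _ u (fun h : R => f (h *: v + x))) => //.
by rewrite scale0r add0r.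
Qed.

(** u^-m exp(-1/u) for u > 0, extended by 0.  All exponents m are needed since
    differentiation raises m; flat 0 is the usual building block of cutoffs. *)
Definition flat (m : nat) (u : R) : R :=
  if 0 < u then u^-1 ^+ m * expR (- u^-1) else 0.

Lemma flat_le0 m u : u <= 0 -> flat m u = 0.
Proof. by rewrite /flat ltNge => ->. Qed.

Lemma flat_ge0 m u : 0 <= flat m u.
Proof.
rewrite /flat; case: ifPn => // u0.
by rewrite mulr_ge0 ?expR_ge0// exprn_ge0// invr_ge0 ltW.
Qed.

(** With y = 1/u: exp y = exp(y/m)^m >= (y/m)^m. *)
Lemma flat_le m u : flat m u <= m%:R ^+ m.
Proof.
rewrite /flat; case: ifPn => u0; last by rewrite exprn_ge0.
have [->|m0] := eqVneq m 0%N.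
  by rewrite !expr0 mul1r -expR0 ler_expR oppr_le0 invr_ge0 ltW.
have y0 : 0 < u^-1 by rewrite invr_gt0.
set y := u^-1 in y0 *.
have m0' : 0 < m%:R :> R by rewrite ltr0n lt0n.
rewrite expRN ler_pdivrMr ?expR_gt0//.
have -> : expR y = expR (y / m%:R) ^+ m.
  by rewrite -expRM_natl mulrC divfK// gt_eqF.
rewrite -exprMn; apply: lerXn2r.
- by rewrite nnegrE ltW.
- by rewrite nnegrE mulr_ge0// expR_ge0.
rewrite mulrC -ler_pdivrMr//.
by apply: le_trans (expR_ge1Dx _); rewrite lerDr.
Qed.

Lemma flatS m u : flat m u = u * flat m.+1 u.
Proof.
rewrite /flat; case: ifPn => u0; last by rewrite mulr0.
by rewrite exprS; field; rewrite gt_eqF.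
Qed.

(** At 0, the identity flat m u = u^2 flat (m+2) u and the boundedness of
    flat (m+2) make flat m a quadratic error. *)
Lemma is_derive_flat m u :
  is_derive u 1 (flat m) (- m%:R * flat m.+1 u + flat m.+2 u).
Proof.
have [u0|u0|->] := ltrgtP u 0.
- rewrite !flat_le0 ?(ltW u0)// mulr0 addr0.
  apply: (@near_eq_is_derive _ _ _ (cst 0)).
  by near=> y; rewrite /= flat_le0// ltW//; near: y; exact: lt_nbhsl.
- apply: (@near_eq_is_derive _ _ _ (fun u => u^-1 ^+ m * expR (- u^-1))).
    by near=> y; rewrite /= /flat ifT//; near: y; exact: lt_nbhsr.
  have u1 : u != 0 by rewrite gt_eqF.
  have D1 : is_derive u 1 (fun y : R => y^-1) (- u^-2).
    by apply: (is_derive_eq (is_deriveV u1 (is_derive_id _ _))); rewrite /GRing.scale/= mulr1.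
  have D2 : is_derive u 1 (fun y : R => expR (- y^-1)) (expR (- u^-1) * u^-2).
    apply: (is_derive_eq (is_derive_comp_dir (is_derive_expR _) (is_deriveN D1))).
    by rewrite opprK.
  have D3 : is_derive u 1 (fun y : R => y^-1 ^+ m) (m%:R * u^-1 ^+ m.-1 * - u^-2).
    by have := is_deriveX m D1; rewrite exprfctE.
  apply: (is_derive_eq (is_deriveM D3 D2)).
  rewrite /flat u0 /GRing.scale/=.
  case: m D3 => [|m] D3; rewrite /= ?mul0r ?mulr0 ?oppr0 ?expr0 ?exprS ?mul0r; field; exact: u1.
- rewrite !flat_le0// mulr0 addr0.
  apply: (@is_derive_quadratic _ _ _ (m.+2%:R ^+ m.+2)) => h.
  rewrite add0r (flat_le0 m (lexx 0)) mul0r !subr0 ger0_norm ?flat_ge0//.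
  rewrite (flatS m) (flatS m.+1) mulrA -expr2 mulrC ler_wpM2r ?sqr_ge0//.
  exact: flat_le.
Unshelve. all: by end_near. Qed.

Definition sqpos (u : R) : R := Num.max u 0 ^+ 2.

Lemma is_derive_sqpos u : is_derive u 1 sqpos (2 * Num.max u 0).
Proof.
apply: (@is_derive_quadratic _ _ _ 1) => h; rewrite /sqpos mul1r.
rewrite ler_norml.
by case: (leP u 0) => ?; case: (leP (u + h) 0) => ?; apply/andP; split; nra.
Qed.

End Calculus.

(** * Classes of smooth functions closed under differentiation *)

Section Smooth.
Context {R : realType}.

(** Finitely many operations, chosen so that the class contains the derivatives
    of its members: infinite differentiability then follows by induction on the
    order, without formulas for higher derivatives. *)
Inductive smooth1 : (R -> R) -> Prop :=
| smooth1_cst c : smooth1 (fun=> c)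
| smooth1_id : smooth1 (fun t => t)
| smooth1_add u v : smooth1 u -> smooth1 v -> smooth1 (fun t => u t + v t)
| smooth1_mul u v : smooth1 u -> smooth1 v -> smooth1 (fun t => u t * v t)
| smooth1_inv u :
    (forall t, u t != 0) -> smooth1 u -> smooth1 (fun t => (u t)^-1)
| smooth1_flat m u : smooth1 u -> smooth1 (fun t => flat m (u t)).

Lemma smooth1_derive u : smooth1 u ->
  exists2 u', smooth1 u' & forall t : R, is_derive t 1 u (u' t).
Proof.
elim=> [c||{}u v _ [u' u's Du] _ [v' v's Dv]|{}u v us [u' u's Du] vs [v' v's Dv]
  |{}u u0 us [u' u's Du]|m {}u us [u' u's Du]].
- by exists (fun=> 0) => [|t]; [exact: smooth1_cst|exact: is_derive_cst].
- by exists (fun=> 1) => [|t]; [exact: smooth1_cst|exact: is_derive_id].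
- exists (fun t => u' t + v' t) => [|t]; first exact: smooth1_add.
  exact: is_deriveD.
- exists (fun t => u t * v' t + v t * u' t) => [|t]; last exact: is_deriveM.
  by apply: smooth1_add; exact: smooth1_mul.
- exists (fun t => (- 1) * ((u t)^-1 * ((u t)^-1 * u' t))) => [|t].
    apply: smooth1_mul; first exact: smooth1_cst.
    by do 2 (apply: smooth1_mul; first exact: smooth1_inv).
  apply: (is_derive_eq (is_deriveV (u0 t) (Du t))).
  by rewrite /GRing.scale/= expr2 invfM; ring.
- exists (fun t => (- m%:R * flat m.+1 (u t) + flat m.+2 (u t)) * u' t) => [|t].
    apply: smooth1_mul => //; apply: smooth1_add; last exact: smooth1_flat.
    by apply: smooth1_mul; [exact: smooth1_cst|exact: smooth1_flat].
  exact: is_derive_comp_dir (is_derive_flat m (u t)) (Du t).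
Qed.

Lemma smooth1_continuous u : smooth1 u -> continuous u.
Proof.
move=> /smooth1_derive[u' _ Du] t.
apply: differentiable_continuous; apply/derivable1_diffP.
exact: ex_derive.
Qed.

Inductive smooth2 : (R * R -> R) -> Prop :=
| smooth2_cst c : smooth2 (fun=> c)
| smooth2_fst : smooth2 (fun x => x.1)
| smooth2_snd : smooth2 (fun x => x.2)
| smooth2_add f g : smooth2 f -> smooth2 g -> smooth2 (fun x => f x + g x)
| smooth2_mul f g : smooth2 f -> smooth2 g -> smooth2 (fun x => f x * g x)
| smooth2_comp u f : smooth1 u -> smooth2 f -> smooth2 (fun x => u (f x)).

Lemma is_derive_fst (x v : R * R) : is_derive x v (fun y : R * R => y.1) v.1.
Proof.
apply/is_derive_dir/(@is_derive_quadratic _ _ _ _ 0) => h /=.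
by rewrite mul0r normr_le0; apply/eqP; rewrite /GRing.scale/=; ring.
Qed.

Lemma is_derive_snd (x v : R * R) : is_derive x v (fun y : R * R => y.2) v.2.
Proof.
apply/is_derive_dir/(@is_derive_quadratic _ _ _ _ 0) => h /=.
by rewrite mul0r normr_le0; apply/eqP; rewrite /GRing.scale/=; ring.
Qed.

Lemma smooth2_derive f v : smooth2 f ->
  exists2 f', smooth2 f' & forall x : R * R, is_derive x v f (f' x).
Proof.
elim=> [c|||{}f g _ [f' fs Df] _ [g' gs Dg]|{}f g fs [f' f's Df] gs [g' g's Dg]
  |u {}f us fs [f' f's Df]].
- by exists (fun=> 0) => [|t]; [exact: smooth2_cst|exact: is_derive_cst].
- by exists (fun=> v.1) => [|t]; [exact: smooth2_cst|exact: is_derive_fst].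
- by exists (fun=> v.2) => [|t]; [exact: smooth2_cst|exact: is_derive_snd].
- exists (fun t => f' t + g' t) => [|t]; first exact: smooth2_add.
  exact: is_deriveD.
- exists (fun t => f t * g' t + g t * f' t) => [|t]; last exact: is_deriveM.
  by apply: smooth2_add; exact: smooth2_mul.
- have [u' u's Du] := smooth1_derive us.
  exists (fun t => u' (f t) * f' t) => [|t].
    by apply: smooth2_mul => //; exact: smooth2_comp.
  exact: is_derive_comp_dir.
Qed.

Lemma smooth2_continuous f : smooth2 f -> continuous f.
Proof.
elim=> [c|||{}f g _ cf _ cg|{}f g _ cf _ cg|u {}f us _ cf] x.
- exact: cvg_cst.
- exact: cvg_fst.
- exact: cvg_snd.
- by apply: cvgD; [exact: cf|exact: cg].
- by apply: cvgM; [exact: cf|exact: cg].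
- by apply: continuous_comp; [exact: cf|exact: smooth1_continuous].
Qed.

(** Both partial derivatives of a member are members, so one induction on k
    suffices. *)
Lemma smooth2_Ck k f : smooth2 f -> Ck k f.
Proof.
elim: k f => [|k IH] f sf; first exact: smooth2_continuous.
have [f1 s1 D1] := smooth2_derive (1, 0) sf.
have [f2 s2 D2] := smooth2_derive (0, 1) sf.
split.
- by move=> x; exact: ex_derive.
- by move=> x; exact: ex_derive.
- rewrite (_ : (fun x => _) = f1); first exact: IH.
  by apply/funext => x; rewrite /grad/= derive_val.
- rewrite (_ : (fun x => _) = f2); first exact: IH.
  by apply/funext => x; rewrite /grad/= derive_val.
Qed.

End Smooth.

(** * The Lebesgue measure of the plane and integrals of partial derivatives *)

Section Plane.
Context {R : realType}.
Local Notation plane := (measurableTypeR R * measurableTypeR R)%type.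

(** Boxes with rational centre and rational half-width form a countable base of
    the plane, and they are measurable rectangles. *)
Lemma open_measurable_plane (A : set (R * R)) : open A -> measurable (A : set plane).
Proof.
move=> oA.
pose box (k : rat * rat * rat) : set plane :=
  `]ratr k.1.1 - ratr k.2, ratr k.1.1 + ratr k.2[ `*`
  `]ratr k.1.2 - ratr k.2, ratr k.1.2 + ratr k.2[.
pose F k := if `[< box k `<=` A >] then box k else set0.
have -> : A = \bigcup_k F k.
  apply/seteqP; split => [[x y] Axy|z [k _]]; last first.
    by rewrite /F; case: ifPn => // /asboolP; exact.
  have /nbhs_ballP[e /= e0 Ae] : nbhs (x, y) A by apply: open_nbhs_nbhs.
  have [r] := @rat_in_itvoo R 0 (e / 2) (divr_gt0 e0 (ltr0n _ 2)).
  rewrite in_itv/= => /andP[r0 re].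
  have rx (c : R) : exists q : rat, c - ratr r < ratr q < c + ratr r.
    have [q] := @rat_in_itvoo R (c - ratr r) (c + ratr r) ltac:(lra).
    by rewrite in_itv/=; exists q.
  have [p /andP[p1 p2]] := rx x; have [q /andP[q1 q2]] := rx y.
  exists (p, q, r) => //; rewrite /F ifT.
    by split; rewrite /= in_itv/=; apply/andP; split; lra.
  apply/asboolP => -[u v] [/=]; rewrite !in_itv/= => /andP[u1 u2] /andP[v1 v2].
  by apply: Ae; split; rewrite /ball/= /ball_ ltr_norml; apply/andP; split; lra.
apply: countable_bigcupT_measurable => // k; rewrite /F; case: ifPn => // _.
by apply: measurableX; exact: measurable_itv.
Qed.

Lemma continuous_measurable_plane (f : R * R -> R) (D : set plane) :
  measurable D -> continuous f -> measurable_fun D (f : plane -> R).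
Proof.
move=> mD /continuousP cf; apply: (measurability _ (RGenOpens.measurableE R)).
move=> _ [_ [a [b ->] <-]]; apply: measurableI => //.
by apply: open_measurable_plane; apply: cf; exact: interval_open.
Qed.

Lemma continuous_dot (f g : R * R -> R * R) :
  continuous (fun x => (f x).1) -> continuous (fun x => (f x).2) ->
  continuous (fun x => (g x).1) -> continuous (fun x => (g x).2) ->
  continuous (fun x => dot (f x) (g x)).
Proof.
move=> f1 f2 g1 g2 x; apply: cvgD; apply: cvgM.
- exact: f1.
- exact: g1.
- exact: f2.
- exact: g2.
Qed.

Lemma continuous_enorm (f : R * R -> R * R) :
  continuous (fun x => (f x).1) -> continuous (fun x => (f x).2) ->
  continuous (fun x => enorm (f x)).
Proof.
move=> f1 f2 x.
apply: (@continuous_comp _ _ _ (fun x => dot (f x) (f x)) Num.sqrt).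
  exact: continuous_dot.
exact: sqrt_continuous.
Qed.

Lemma dot_ge0 (u : R * R) : 0 <= dot u u.
Proof. by rewrite /dot addr_ge0// -expr2 sqr_ge0. Qed.

Lemma sqr_enorm (u : R * R) : enorm u ^+ 2 = dot u u.
Proof. by rewrite sqr_sqrtr// dot_ge0. Qed.

Lemma diskE (x : R * R) : disk x <-> dot x x < 1.
Proof.
rewrite /disk/=; split => [x1|].
  rewrite -sqr_enorm; have := sqrtr_ge0 (dot x x); rewrite -/(enorm x); nra.
by move=> x1; rewrite /enorm -[ltRHS]sqrtr1 ltr_sqrt.
Qed.

Lemma open_disk : open (disk : set (R * R)).
Proof.
rewrite (_ : disk = enorm @^-1` [set y | y < 1])//.
apply: open_comp; last exact: open_lt.
by move=> x _; apply: (@continuous_enorm id) => y; [exact: cvg_fst|exact: cvg_snd].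
Qed.

Lemma measurable_disk : measurable (disk : set plane).
Proof. by apply: open_measurable_plane; exact: open_disk. Qed.

Lemma disk_coord (x : R * R) : disk x -> [/\ -1 < x.1, x.1 < 1, -1 < x.2 & x.2 < 1].
Proof.
case: x => u v /diskE; rewrite /dot/= => uv1.
have u0 := sqr_ge0 u; have v0 := sqr_ge0 v; rewrite !expr2 in u0 v0.
by split; nra.
Qed.

Lemma leb2_box (b1 b2 b3 b4 : bool) (a b c d : R) : a <= b -> c <= d ->
  leb2 ([set` Interval (BSide b1 a) (BSide b2 b)] `*`
        [set` Interval (BSide b3 c) (BSide b4 d)]) = ((b - a) * (d - c))%:E.
Proof.
move=> ab cd.
have mI (i : interval R) : measurable ([set` i] : set (measurableTypeR R)).
  exact: measurable_itv.
transitivity (@lebesgue_measure R [set` Interval (BSide b1 a) (BSide b2 b)] *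
              @lebesgue_measure R [set` Interval (BSide b3 c) (BSide b4 d)])%E.
  exact: (@product_measure1E _ _ _ _ R lebesgue_measure lebesgue_measure _ _
           (mI _) (mI _)).
rewrite !lebesgue_measure_itv/= !lte_fin EFinM.
congr (_ * _)%E; (case: ltgtP; [by []| |]).
- by rewrite ltNge ab.
- by move=> ->; rewrite subrr.
- by rewrite ltNge cd.
- by move=> ->; rewrite subrr.
Qed.

Definition square : set plane := `[-1, 1] `*` `[-1, 1].

Lemma measurable_square : measurable square.
Proof. by apply: measurableX; exact: measurable_itv. Qed.

Lemma disk_square : disk `<=` square.
Proof.
by move=> x /disk_coord[? ? ? ?]; split; rewrite /= in_itv/=; apply/andP; split; exact: ltW.
Qed.

Lemma leb2_disk : (@leb2 R disk < +oo)%E.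
Proof.
apply: (@le_lt_trans _ _ (@leb2 R square)).
  apply: le_measure; rewrite ?inE; [exact: measurable_disk|exact: measurable_square|].
  exact: disk_square.
by rewrite leb2_box ?ltry//; lra.
Qed.

(** Bounds on the closed square serve as bounds on the disk, which is not
    compact. *)
Lemma continuous_bounded_square (f : R * R -> R) : continuous f ->
  exists2 C : R, 0 <= C & forall x, square x -> `|f x| <= C.
Proof.
move=> cf.
have cf' : continuous (fun x => `|f x|).
  by move=> x; apply: continuous_comp; [exact: cf|exact: norm_continuous].
have cs : compact (square : set (R * R)).
  by apply: compact_setX; exact: segment_compact.
have [|c _ Hc] := @compact_EVT_max _ R _ (square : set (R * R)) _ cs (continuous_subspaceT cf').
  by exists (0, 0); split; rewrite /= in_itv/=; apply/andP; split; lra.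
by exists `|f c| => // x sx; apply: Hc; rewrite inE.
Qed.

Lemma bounded_integrable (D : set plane) (f : R * R -> R) C :
  measurable D -> (leb2 D < +oo)%E -> measurable_fun D (f : plane -> R) ->
  (forall x, D x -> `|f x| <= C) -> leb2.-integrable D (EFin \o f).
Proof.
move=> mD Doo mf fC; apply: measurable_bounded_integrable => //.
exists C; split; first by rewrite num_real.
by move=> M CM x Dx /=; apply: (le_trans (fC _ Dx)); exact: ltW.
Qed.

Lemma continuous_integrable_disk (f : R * R -> R) : continuous f ->
  leb2.-integrable disk (EFin \o f).
Proof.
move=> cf; have [C _ fC] := continuous_bounded_square cf.
apply: (@bounded_integrable _ _ C) => //; first exact: measurable_disk.
- exact: leb2_disk.
- by apply: continuous_measurable_plane => //; exact: measurable_disk.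
- by move=> x /disk_square; exact: fC.
Qed.

Lemma continuous_pairl (y : R) : continuous (fun t : R => (t, y)).
Proof.
move=> t; apply: (@cvg_pair _ _ _ (nbhs t) (nbhs t) (nbhs y) _ _ _ id (cst y)).
  exact: cvg_id.
exact: cvg_cst.
Qed.

Lemma continuous_pairr (y : R) : continuous (fun t : R => (y, t)).
Proof.
move=> t; apply: (@cvg_pair _ _ _ (nbhs t) (nbhs y) (nbhs t) _ _ _ (cst y) id).
  exact: cvg_cst.
exact: cvg_id.
Qed.

(** F vanishes at both ends of [-1, 1]. *)
Lemma FTC_box (F f : R -> R) : (forall t : R, is_derive t 1 F (f t)) -> continuous f ->
  (forall t, ~ (-1 < t < 1) -> f t = 0) ->
  (forall t, ~ (-1 < t < 1) -> F t = 0) ->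
  (\int[@lebesgue_measure R]_t (f t)%:E = 0)%E.
Proof.
move=> DF cf f0 F0.
have cF : continuous F.
  move=> t; apply: differentiable_continuous; apply/derivable1_diffP.
  exact: ex_derive.
have E : (\int[lebesgue_measure]_(t in `[(-1)%R, 1%R]) (f t)%:E = 0)%E.
  rewrite (@continuous_FTC2 R f F).
  - rewrite (F0 1); last by case/andP; rewrite ltxx.
    by rewrite (F0 (-1)) ?sube0//; case/andP; rewrite ltxx.
  - by lra.
  - exact: continuous_subspaceT.
  - split.
    + by move=> t _; exact: ex_derive.
    + by apply: cvg_at_right_filter; exact: cF.
    + by apply: cvg_at_left_filter; exact: cF.
  - by move=> t _; rewrite derive1E derive_val.
rewrite -[RHS]E [RHS]integral_mkcond; apply: eq_integral => t _.
rewrite patchE; case: ifPn => // /negP tI.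
rewrite f0//= => t1; apply: tI; rewrite inE/= in_itv/=.
by case/andP: t1 => /ltW -> /ltW ->.
Qed.

Section Divergence.
Variables (F f : R * R -> R).
Hypothesis cf : continuous f.
Hypothesis f0 : forall x, ~ disk x -> f x = 0.
Hypothesis F0 : forall x, ~ disk x -> F x = 0.

(** Needed over the whole plane, since that is where Fubini applies. *)
Lemma integrable_supported :
  (@lebesgue_measure R \x @lebesgue_measure R)%E.-integrable setT (EFin \o f : plane -> \bar R).
Proof.
have := continuous_integrable_disk cf.
move=> /(integrable_mkcond _ measurable_disk).
congr integrable; apply/funext => x; rewrite patchE/=.
by case: ifPn => // /negP; rewrite inE => xd; rewrite f0.
Qed.

Lemma supported_RintegralE :
  \int[leb2]_(x in disk) f x = fine (\int[(@lebesgue_measure R \x @lebesgue_measure R)]_x (f x)%:E)%E.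
Proof.
rewrite Rintegral_mkcond /Rintegral; congr fine; apply: eq_integral => x _.
rewrite patchE/=; case: ifPn => // /negP; rewrite inE => xd; by rewrite f0.
Qed.

(** Fubini, integrating first in the direction of the derivative: every line
    parallel to an axis leaves the disk before its points reach the square's
    sides. *)
Lemma Rintegral_derive1 : (forall x, is_derive x ((1, 0) : R * R) F (f x)) ->
  \int[leb2]_(x in disk) f x = 0.
Proof.
move=> DF; rewrite supported_RintegralE -integral21_prod_meas1; last exact: integrable_supported.
rewrite integral0_eq// => y _; rewrite /fubini_G/=.
have out (t : R) : ~ (-1 < t < 1) -> ~ disk (t, y).
  by move=> nt /disk_coord[/= ? ? _ _]; apply: nt; apply/andP.
apply: (@FTC_box (fun t => F (t, y)) (fun t => f (t, y))).
- move=> t; apply/is_derive_dir; have /is_derive_dir := DF (t, y).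
  congr is_derive; apply/funext => h; congr F.
  by rewrite -[in RHS](add0r y) -[in RHS](scaler0 R h).
- move=> t; apply: (@continuous_comp _ _ _ (fun t : R => (t, y)) f); last exact: cf.
  exact: continuous_pairl.
- by move=> t /out; exact: f0.
- by move=> t /out; exact: F0.
Qed.

Lemma Rintegral_derive2 : (forall x, is_derive x ((0, 1) : R * R) F (f x)) ->
  \int[leb2]_(x in disk) f x = 0.
Proof.
move=> DF; rewrite supported_RintegralE -integral12_prod_meas1; last exact: integrable_supported.
rewrite integral0_eq// => y _; rewrite /fubini_F/=.
have out (t : R) : ~ (-1 < t < 1) -> ~ disk (y, t).
  by move=> nt /disk_coord[/= _ _ ? ?]; apply: nt; apply/andP.
apply: (@FTC_box (fun t => F (y, t)) (fun t => f (y, t))).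
- move=> t; apply/is_derive_dir; have /is_derive_dir := DF (y, t).
  congr is_derive; apply/funext => h; congr F.
  by rewrite -[in RHS](add0r y) -[in RHS](scaler0 R h).
- move=> t; apply: (@continuous_comp _ _ _ (fun t : R => (y, t)) f); last exact: cf.
  exact: continuous_pairr.
- by move=> t /out; exact: f0.
- by move=> t /out; exact: F0.
Qed.

End Divergence.

End Plane.

(** * Integration by parts and the Poincare inequality *)

Section Gradients.
Context {R : realType}.

(** Partial derivatives together with their continuity, with the gradient G
    recorded explicitly so that it can be computed through products and sums. *)
Definition C1 (f : R * R -> R) (G : R * R -> R * R) : Prop :=
  [/\ continuous f,
      forall x, is_derive x ((1, 0) : R * R) f (G x).1,
      forall x, is_derive x ((0, 1) : R * R) f (G x).2,
      continuous (fun x => (G x).1) & continuous (fun x => (G x).2)].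

Lemma continuous_addf (f g : R * R -> R) : continuous f -> continuous g ->
  continuous (fun x => f x + g x).
Proof. by move=> cf cg x; apply: cvgD; [exact: cf|exact: cg]. Qed.

Lemma continuous_mulf (f g : R * R -> R) : continuous f -> continuous g ->
  continuous (fun x => f x * g x).
Proof. by move=> cf cg x; apply: cvgM; [exact: cf|exact: cg]. Qed.

Lemma eq_C1 f G G' : C1 f G -> G =1 G' -> C1 f G'.
Proof. by move=> Cf /funext <-. Qed.

Lemma C1_fst : C1 (fun x : R * R => x.1) (fun=> (1, 0)).
Proof.
split; [exact: smooth2_continuous (@smooth2_fst R)| | | |].
- by move=> x; exact: is_derive_fst.
- by move=> x; exact: is_derive_fst.
- by move=> x; exact: cvg_cst.
- by move=> x; exact: cvg_cst.
Qed.

Lemma C1_snd : C1 (fun x : R * R => x.2) (fun=> (0, 1)).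
Proof.
split; [exact: smooth2_continuous (@smooth2_snd R)| | | |].
- by move=> x; exact: is_derive_snd.
- by move=> x; exact: is_derive_snd.
- by move=> x; exact: cvg_cst.
- by move=> x; exact: cvg_cst.
Qed.

Lemma C1_add f Gf g Gg : C1 f Gf -> C1 g Gg ->
  C1 (fun x => f x + g x) (fun x => Gf x + Gg x).
Proof.
move=> [cf f1 f2 cf1 cf2] [cg g1 g2 cg1 cg2]; split => /=.
- exact: continuous_addf.
- by move=> x; exact: (is_deriveD (f1 x) (g1 x)).
- by move=> x; exact: (is_deriveD (f2 x) (g2 x)).
- exact: (continuous_addf cf1 cg1).
- exact: (continuous_addf cf2 cg2).
Qed.

Lemma C1_mul f Gf g Gg : C1 f Gf -> C1 g Gg ->
  C1 (fun x => f x * g x)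
     (fun x => (f x * (Gg x).1 + g x * (Gf x).1, f x * (Gg x).2 + g x * (Gf x).2)).
Proof.
move=> [cf f1 f2 cf1 cf2] [cg g1 g2 cg1 cg2]; split => /=.
- exact: continuous_mulf.
- by move=> x; exact: (is_deriveM (f1 x) (g1 x)).
- by move=> x; exact: (is_deriveM (f2 x) (g2 x)).
- by apply: continuous_addf; exact: continuous_mulf.
- by apply: continuous_addf; exact: continuous_mulf.
Qed.

Lemma C1_sub f Gf g Gg : C1 f Gf -> C1 g Gg ->
  C1 (fun x => f x - g x) (fun x => Gf x - Gg x).
Proof.
move=> [cf f1 f2 cf1 cf2] [cg g1 g2 cg1 cg2]; split => /=.
- by move=> x; apply: cvgB; [exact: cf|exact: cg].
- by move=> x; exact: (is_deriveB (f1 x) (g1 x)).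
- by move=> x; exact: (is_deriveB (f2 x) (g2 x)).
- by move=> x; apply: cvgB; [exact: cf1|exact: cg1].
- by move=> x; apply: cvgB; [exact: cf2|exact: cg2].
Qed.

Lemma smooth2_C1 f : smooth2 f -> C1 f (grad f).
Proof.
move=> sf; have [f1 s1 D1] := smooth2_derive (1, 0) sf.
have [f2 s2 D2] := smooth2_derive (0, 1) sf.
split; [exact: smooth2_continuous| | | |].
- by move=> x; rewrite /grad/= derive_val; exact: D1.
- by move=> x; rewrite /grad/= derive_val; exact: D2.
- rewrite (_ : (fun x => _) = f1); first exact: smooth2_continuous.
  by apply/funext => x; rewrite /grad/= derive_val.
- rewrite (_ : (fun x => _) = f2); first exact: smooth2_continuous.
  by apply/funext => x; rewrite /grad/= derive_val.
Qed.

Lemma C1_grad f G : C1 f G -> grad f = G.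
Proof.
move=> [_ f1 f2 _ _]; apply/funext => x.
rewrite /grad (surjective_pairing (G x)); congr pair.
  by have F := f1 x; rewrite derive_val.
by have F := f2 x; rewrite derive_val.
Qed.

Lemma test_function_C1 (eta : R * R -> R) : test_function eta -> C1 eta (grad eta).
Proof.
move=> [smooth _ _]; have [d1 d2 c1 c2] := smooth 1%N.
split; [exact: (smooth 0%N)|move=> x|move=> x|exact: c1|exact: c2].
  exact: derivableP (d1 x).
exact: derivableP (d2 x).
Qed.

(** The condition under which integration by parts over the disk has no boundary
    term; the gradient is included because it is integrated along lines leaving
    the disk. *)
Definition supported (f : R * R -> R) (G : R * R -> R * R) :=
  forall x, ~ disk x -> f x = 0 /\ G x = 0.

(** A point outside the disk lies outside the closed support, hence has a
    neighbourhood on which eta vanishes. *)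
Lemma test_function_supported (eta : R * R -> R) :
  test_function eta -> supported eta (grad eta).
Proof.
move=> [_ _ sub] x xd.
have xs : ~ closure [set x | eta x != 0] x by move=> /sub.
have near0 : \near x, cst 0 x = eta x.
  have : open_nbhs x (~` closure [set x | eta x != 0]).
    by split => //; apply: closed_openC; exact: closed_closure.
  move=> /open_nbhs_nbhs; apply: filterS => y /= yc.
  apply/esym/eqP; apply: contra_notT yc => y0.
  exact: subset_closure.
split; first by have /nbhs_singleton := near0.
rewrite /grad; congr pair.
  by have F := near_eq_is_derive near0 (is_derive_cst 0 x ((1, 0) : R * R)); rewrite derive_val.
by have F := near_eq_is_derive near0 (is_derive_cst 0 x ((0, 1) : R * R)); rewrite derive_val.
Qed.

Lemma supported_sub f Gf g Gg : supported f Gf -> supported g Gg ->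
  supported (fun x => f x - g x) (fun x => Gf x - Gg x).
Proof.
move=> sf sg x xd; have [-> ->] := sf _ xd; have [-> ->] := sg _ xd.
by rewrite !subr0.
Qed.

Lemma supported_mulr f Gf g Gg : supported g Gg ->
  supported (fun x => f x * g x)
     (fun x => (f x * (Gg x).1 + g x * (Gf x).1, f x * (Gg x).2 + g x * (Gf x).2)).
Proof.
by move=> sg x xd; have [-> ->] := sg _ xd; rewrite /= !(mulr0, mul0r) addr0.
Qed.

Lemma divergence_free f G : C1 f G -> supported f G ->
  \int[leb2]_(x in disk) (G x).1 = 0 /\ \int[leb2]_(x in disk) (G x).2 = 0.
Proof.
move=> [cf f1 f2 cG1 cG2] sf; split.
- apply: (@Rintegral_derive1 _ f) => // x /sf[fx Gx] //.
  by rewrite Gx.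
- apply: (@Rintegral_derive2 _ f) => // x /sf[fx Gx] //.
  by rewrite Gx.
Qed.

Lemma integration_by_parts_disk f Gf g Gg : C1 f Gf -> C1 g Gg -> supported g Gg ->
  (\int[leb2]_(x in disk) (f x * (Gg x).1)) =
      - (\int[leb2]_(x in disk) ((Gf x).1 * g x)) /\
  (\int[leb2]_(x in disk) (f x * (Gg x).2)) =
      - (\int[leb2]_(x in disk) ((Gf x).2 * g x)).
Proof.
move=> Cf Cg sg.
have [/=] := divergence_free (C1_mul Cf Cg) (@supported_mulr f Gf _ _ sg).
case: Cf => cf f1 f2 cf1 cf2; case: Cg => cg g1 g2 cg1 cg2.
rewrite !RintegralD//; try exact: measurable_disk;
  try (apply: continuous_integrable_disk; exact: continuous_mulf).
move=> /eqP; rewrite addr_eq0 => /eqP -> /eqP; rewrite addr_eq0 => /eqP ->.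
by split; congr (- _); apply: eq_Rintegral => x _; rewrite mulrC.
Qed.

(** Integrating d_1 (x_1 w^2) = w^2 + 2 x_1 w d_1 w over the disk gives 0, and
    4 (d_1 w)^2 - w^2 + 2 (w^2 + 2 x_1 w d_1 w)
      = (2 d_1 w + x_1 w)^2 + (1 - x_1^2) w^2 >= 0. *)
Lemma poincare w G : C1 w G -> supported w G ->
  \int[leb2]_(x in disk) (w x ^+ 2) <= 4 * \int[leb2]_(x in disk) ((G x).1 ^+ 2).
Proof.
move=> Cw sw.
have C2 := C1_mul Cw Cw.
have [cid _ _ _ _] := C1_fst.
have C3 := C1_mul C1_fst C2.
have s3 := @supported_mulr _ (fun=> (1, 0)) _ _ (@supported_mulr _ G _ _ sw).
have [+ _] := divergence_free C3 (s3 (fun x : R * R => x.1) w).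
case: Cw => cw _ _ cG _; move=> /= E.
have cw2 : continuous (fun x => w x ^+ 2) by exact: continuous_mulf.
have cG2 : continuous (fun x => (G x).1 ^+ 2).
  exact: (@continuous_mulf (fun x => (G x).1) (fun x => (G x).1)).
have cE : continuous (fun x : R * R => x.1 * (w x * (G x).1 + w x * (G x).1) + w x * w x * 1).
  by do ![apply: continuous_addf | apply: continuous_mulf] => // x; exact: cvg_cst.
have cZ (c : R) f : continuous f -> continuous (fun x : R * R => c * f x).
  by move=> cf; apply: continuous_mulf => // x; exact: cvg_cst.
have mD := @measurable_disk R.
have : 0 <= \int[leb2]_(x in disk) ((4 * (G x).1 ^+ 2 + (-1) * w x ^+ 2) +
    2 * (x.1 * (w x * (G x).1 + w x * (G x).1) + w x * w x * 1)).
  apply: Rintegral_ge0 => x /disk_coord[x1 x2 _ _].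
  set g := (G x).1; set u := w x; set t := x.1 in x1 x2 *.
  have -> : 4 * g ^+ 2 + -1 * u ^+ 2 + 2 * (t * (u * g + u * g) + u * u * 1) =
    (2 * g + t * u) ^+ 2 + (1 - t ^+ 2) * u ^+ 2 by ring.
  by rewrite addr_ge0 ?sqr_ge0// mulr_ge0 ?sqr_ge0//; nra.
rewrite RintegralD//; last 2 first.
- by apply: continuous_integrable_disk; apply: continuous_addf; exact: cZ.
- by apply: continuous_integrable_disk; exact: cZ.
rewrite RintegralD//; [|by apply: continuous_integrable_disk; exact: cZ..].
rewrite !RintegralZl ?E//; [|exact: continuous_integrable_disk..].
lra.
Qed.

End Gradients.

(** * Squared norms *)

Section L2.
Context {R : realType}.
Local Notation plane := (measurableTypeR R * measurableTypeR R)%type.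
Implicit Types f g : R * R -> R.

(** Squared L^2 norms compare and add directly by monotonicity and linearity of
    the integral; square roots are only taken at the end. *)
Definition energy f : \bar R := (\int[leb2]_(x in disk) (f x ^+ 2)%:E)%E.

Lemma energy_ge0 f : (0 <= energy f)%E.
Proof. by apply: integral_ge0 => x _; rewrite lee_fin sqr_ge0. Qed.

Lemma L2norm_energy f : L2norm f = sqrte (energy f).
Proof.
rewrite -poweR12_sqrt ?energy_ge0// /L2norm unlock; congr poweR.
rewrite /energy [RHS]integral_mkcond; apply: eq_integral => x _ /=.
rewrite !patchE; case: ifPn => _; last by rewrite normr0 powR0.
by rewrite powR_mulrn ?normr_ge0// real_normK// num_real.
Qed.

Lemma L2norm_lty f : (L2norm f < +oo)%E = (energy f < +oo)%E.
Proof.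
rewrite L2norm_energy -!ge0_fin_numE ?sqrte_ge0 ?energy_ge0//.
by rewrite sqrte_fin_num ?energy_ge0.
Qed.

Lemma measurable_sqr f : measurable_fun disk (f : plane -> R) ->
  measurable_fun (disk : set plane) (EFin \o (fun x => f x ^+ 2)).
Proof. by move=> mf; apply/measurable_EFinP; exact: measurable_funX. Qed.

Lemma le_energy f g : measurable_fun disk (f : plane -> R) ->
  measurable_fun disk (g : plane -> R) ->
  (forall x, disk x -> f x ^+ 2 <= g x ^+ 2) -> (energy f <= energy g)%E.
Proof.
move=> mf mg fg; apply: ge0_le_integral.
- exact: measurable_disk.
- by move=> x _; rewrite lee_fin sqr_ge0.
- exact: measurable_sqr.
- exact: measurable_sqr.
- by move=> x /fg; rewrite lee_fin.
Qed.

(** (f + g)^2 <= 2 f^2 + 2 g^2; the constant is harmless for limits. *)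
Lemma energyD f g : measurable_fun disk (f : plane -> R) ->
  measurable_fun disk (g : plane -> R) ->
  (energy (fun x => (f x + g x)%R) <= 2%:E * (energy f + energy g))%E.
Proof.
move=> mf mg; rewrite /energy -ge0_integralD; last 5 first.
- exact: measurable_disk.
- by move=> x _; rewrite lee_fin sqr_ge0.
- exact: measurable_sqr.
- by move=> x _; rewrite lee_fin sqr_ge0.
- exact: measurable_sqr.
rewrite -ge0_integralZl; last 4 first.
- exact: measurable_disk.
- by apply: emeasurable_funD; exact: measurable_sqr.
- by move=> x _; rewrite lee_fin addr_ge0 ?sqr_ge0.
- by rewrite lee_fin.
apply: ge0_le_integral.
- exact: measurable_disk.
- by move=> x _; rewrite lee_fin sqr_ge0.
- by apply: measurable_sqr; exact: measurable_funD.
- apply: emeasurable_funM => //; apply: emeasurable_funD; exact: measurable_sqr.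
- move=> x _; rewrite lee_fin -subr_ge0.
  by rewrite (_ : _ - _ = (f x - g x) ^+ 2) ?sqr_ge0//; ring.
Qed.

Lemma energy_Rintegral f : continuous f ->
  energy f = (\int[leb2]_(x in disk) (f x ^+ 2))%:E.
Proof.
move=> cf; rewrite /Rintegral fineK//; apply: integrable_fin_num.
  exact: measurable_disk.
apply: (@continuous_integrable_disk _ (fun x => f x ^+ 2)).
exact: (continuous_mulf cf cf).
Qed.

Lemma continuous_L2 f : continuous f -> L2 f.
Proof.
move=> cf; split; last by rewrite L2norm_lty energy_Rintegral// ltry.
by apply: continuous_measurable_plane => //; exact: measurable_disk.
Qed.

Lemma C1_W12 f G : C1 f G -> W12 f G.
Proof.
move=> Cf; have [cf _ _ c1 c2] := Cf; split; try exact: continuous_L2.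
move=> eta teta.
exact: integration_by_parts_disk Cf (test_function_C1 teta) (test_function_supported teta).
Qed.

Lemma cvg_L2norm0 (f : nat -> R * R -> R) :
  L2norm (f n) @[n --> \oo] --> 0%E ->
  forall e : R, 0 < e -> \forall n \near \oo, (energy (f n) <= e%:E)%E.
Proof.
move=> /fine_cvgP[fin /= c] e e0.
have s0 : 0 < Num.sqrt e by rewrite sqrtr_gt0.
have lt := cvgr_lt _ c _ s0.
near=> n.
have : fine (L2norm (f n)) < Num.sqrt e by near: n; exact: lt.
have : L2norm (f n) \is a fin_num by near: n; exact: fin.
rewrite L2norm_energy.
have := energy_ge0 (f n); case: (energy (f n)) => [r|//|//] /=.
by rewrite !lee_fin ltr_sqrt// => _ _ /ltW.
Unshelve. all: by end_near. Qed.

Lemma energy_cvg0 (f : nat -> R * R -> R) :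
  energy (f n) @[n --> \oo] --> 0%E -> L2norm (f n) @[n --> \oo] --> 0%E.
Proof.
move=> /fine_cvgP[fin /= cf]; apply/fine_cvgP; split.
  apply: filterS fin => n.
  by rewrite L2norm_energy sqrte_fin_num ?energy_ge0.
rewrite (_ : _ \o _ = Num.sqrt \o (fun n => fine (energy (f n)))).
  rewrite -[X in _ --> X]sqrtr0; apply: continuous_cvg => //.
  exact: sqrt_continuous.
apply/funext => n /=; rewrite L2norm_energy.
by case: (energy (f n)) => //=; rewrite sqrtr0.
Qed.

End L2.

(** * Uniqueness for the Dirichlet problem *)

Section Uniqueness.
Context {R : realType}.
Local Notation plane := (measurableTypeR R * measurableTypeR R)%type.
Implicit Types f g : R * R -> R.
#[local] Arguments enorm {R} u%_ring_scope.

Lemma energy_lty_integrable f : measurable_fun disk (f : plane -> R) ->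
  (energy f < +oo)%E -> leb2.-integrable disk (EFin \o (fun x => f x ^+ 2)).
Proof.
move=> mf fy; apply/integrableP; split; first exact: measurable_sqr.
apply: le_lt_trans fy; apply: ge0_le_integral.
- exact: measurable_disk.
- by [].
- by apply: measurableT_comp => //; exact: measurable_sqr.
- exact: measurable_sqr.
- by move=> x _ /=; rewrite lee_fin ger0_norm// sqr_ge0.
Qed.

(** |f| <= 1 + f^2 and the disk has finite measure. *)
Lemma L2_integrable f : L2 f -> leb2.-integrable disk (EFin \o f).
Proof.
move=> [mf]; rewrite L2norm_lty => fy.
have i2 := energy_lty_integrable mf fy.
have i1 : leb2.-integrable disk (EFin \o (fun=> 1 : R)).
  by apply: continuous_integrable_disk => x; exact: cvg_cst.
have mD := @measurable_disk R.
apply: (le_integrable mD _ _ (integrableD mD i1 i2)).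
- exact/measurable_EFinP.
- move=> x _ /=; rewrite lee_fin [leRHS]ger0_norm ?addr_ge0 ?sqr_ge0//.
  by rewrite ler_norml; apply/andP; split; nra.
Qed.

Lemma L2_mul_integrable f g : L2 f -> continuous g ->
  leb2.-integrable disk (EFin \o (fun x => f x * g x)).
Proof.
move=> Lf cg; have [C C0 gC] := continuous_bounded_square cg.
apply: (integrableMl (@measurable_disk R) (L2_integrable Lf)).
  by apply: continuous_measurable_plane => //; exact: measurable_disk.
exists C; split; first by rewrite num_real.
by move=> M CM x /disk_square sx /=; apply: (le_trans (gC _ sx)); exact: ltW.
Qed.

Lemma dot_integrable (G K : R * R -> R * R) :
  L2 (fun x => (G x).1) -> L2 (fun x => (G x).2) ->
  continuous (fun x => (K x).1) -> continuous (fun x => (K x).2) ->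
  leb2.-integrable disk (EFin \o (fun x => dot (G x) (K x))).
Proof.
move=> G1 G2 K1 K2.
exact: (integrableD (@measurable_disk R) (L2_mul_integrable G1 K1) (L2_mul_integrable G2 K2)).
Qed.

Lemma measurable_dot (D : set plane) (G K : R * R -> R * R) :
  measurable_fun D (fun x : plane => (G x).1) -> measurable_fun D (fun x : plane => (G x).2) ->
  measurable_fun D (fun x : plane => (K x).1) -> measurable_fun D (fun x : plane => (K x).2) ->
  measurable_fun D (fun x : plane => dot (G x) (K x)).
Proof.
by move=> G1 G2 K1 K2; apply: measurable_funD; exact: measurable_funM.
Qed.

Lemma measurable_enorm (D : set plane) (G : R * R -> R * R) :
  measurable_fun D (fun x : plane => (G x).1) -> measurable_fun D (fun x : plane => (G x).2) ->
  measurable_fun D (fun x : plane => enorm (G x)).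
Proof.
move=> G1 G2.
have ms : measurable_fun setT (Num.sqrt : R -> R).
  by apply: continuous_measurable_fun; exact: sqrt_continuous.
exact: (measurableT_comp ms (measurable_dot G1 G2 G1 G2)).
Qed.

Lemma enormB (u v : R * R) : enorm (u - v) <= enorm u + enorm v.
Proof.
have u0 : 0 <= enorm u := sqrtr_ge0 _.
have v0 : 0 <= enorm v := sqrtr_ge0 _.
rewrite -(ler_pXn2r (ltn0Sn 1)) ?nnegrE ?addr_ge0 ?sqrtr_ge0//.
rewrite sqrrD !sqr_enorm.
have CS : - (enorm u * enorm v) <= dot u v.
  have : `|dot u v| <= enorm u * enorm v.
    rewrite -(ler_pXn2r (ltn0Sn 1)) ?nnegrE ?mulr_ge0//.
    rewrite real_normK ?num_real// exprMn !sqr_enorm -subr_ge0 /dot.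
    (* Lagrange's identity *)
    rewrite (_ : _ - _ = (u.1 * v.2 - u.2 * v.1) ^+ 2) ?sqr_ge0//.
    by ring.
  by rewrite ler_norml => /andP[].
have -> : dot (u - v) (u - v) = dot u u - 2 * dot u v + dot v v.
  by rewrite /dot /=; ring.
by rewrite -mulr_natr; lra.
Qed.

Lemma energy_enormB (G K : R * R -> R * R) :
  L2 (fun x => (G x).1) -> L2 (fun x => (G x).2) ->
  L2 (fun x => (K x).1) -> L2 (fun x => (K x).2) ->
  (energy (fun x => enorm (G x - K x)) <=
     2%:E * (energy (fun x => enorm (G x)) + energy (fun x => enorm (K x))))%E.
Proof.
move=> [G1 _] [G2 _] [K1 _] [K2 _].
have mG := measurable_enorm G1 G2; have mK := measurable_enorm K1 K2.
apply: le_trans (energyD mG mK); apply: le_energy.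
- apply: measurable_enorm; exact: measurable_funB.
- exact: measurable_funD.
- move=> x _; have := enormB (G x) (K x).
  by rewrite ler_pXn2r ?nnegrE ?addr_ge0 ?sqrtr_ge0.
Qed.

Lemma eq_energy f g : (forall x, disk x -> f x ^+ 2 = g x ^+ 2) -> energy f = energy g.
Proof.
by move=> fg; apply: eq_integral => x; rewrite inE => /fg ->.
Qed.

Lemma energy_eq0 f : measurable_fun disk (f : plane -> R) -> energy f = 0%E ->
  f = cst 0 %[ae leb2 in disk].
Proof.
move=> mf f0.
have /(ae_eq_integral_abs leb2 (@measurable_disk R) (measurable_sqr mf)) :
    (\int[@leb2 R]_(x in disk) `|(EFin \o (fun x => f x ^+ 2)%R) x| = 0)%E.
  rewrite -[RHS]f0; apply: eq_integral => x _ /=.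
  by rewrite ger0_norm// sqr_ge0.
apply: filterS => x /= H xd.
by have [/eqP] := H xd; rewrite sqrf_eq0 => /eqP.
Qed.

(** Pythagoras: |W - D|^2 - (|W|^2 - 2 D.W) = |D|^2 >= 0, and the integral of
    D.W vanishes. *)
Lemma energy_orthogonal (D W : R * R -> R * R) :
  L2 (fun x => (D x).1) -> L2 (fun x => (D x).2) ->
  continuous (fun x => (W x).1) -> continuous (fun x => (W x).2) ->
  \int[leb2]_(x in disk) dot (D x) (W x) = 0 ->
  (energy (fun x => enorm (W x)) <= energy (fun x => enorm (W x - D x)))%E.
Proof.
move=> D1 D2 W1 W2 DW.
have mD := @measurable_disk R.
have [->|fin] := eqVneq (energy (fun x => enorm (W x - D x))) +oo%E; first exact: leey.
have iWD : leb2.-integrable disk (EFin \o (fun x => enorm (W x - D x) ^+ 2)).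
  apply: energy_lty_integrable; last by rewrite lt_neqAle fin leey.
  have [mW1 _] := continuous_L2 W1; have [mW2 _] := continuous_L2 W2.
  by apply: measurable_enorm; apply: measurable_funB => //; [case: D1|case: D2].
have iW : leb2.-integrable disk (EFin \o (fun x => dot (W x) (W x))).
  by apply: dot_integrable => //; exact: continuous_L2.
have iDW := dot_integrable D1 D2 W1 W2.
have i2 : leb2.-integrable disk (EFin \o (fun x => (-2) * dot (D x) (W x))).
  exact: (integrableZl mD (-2) iDW).
have -> : energy (fun x => enorm (W x)) =
    (\int[@leb2 R]_(x in disk) (EFin \o (fun x => (dot (W x) (W x) + (-2) * dot (D x) (W x))%R)) x)%E.
  have E2 : (\int[@leb2 R]_(x in disk) (EFin \o (fun x => (-2) * dot (D x) (W x))%R) x = 0)%E.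
    rewrite -(fineK (integrable_fin_num mD i2)); congr EFin.
    by have := RintegralZl (-2) mD iDW; rewrite DW mulr0.
  transitivity (\int[@leb2 R]_(x in disk) (EFin \o (fun x => dot (W x) (W x))) x +
     \int[@leb2 R]_(x in disk) (EFin \o (fun x => (-2) * dot (D x) (W x))%R) x)%E.
    by rewrite E2 adde0; apply: eq_integral => x _; rewrite /= sqr_enorm.
  by rewrite -integralD.
apply: le_integral => //.
  exact: (integrableD mD iW i2).
move=> x _ /=; rewrite lee_fin sqr_enorm -subr_ge0.
rewrite (_ : _ - _ = dot (D x) (D x)) ?dot_ge0// /dot/=; ring.
Qed.

(** Let eta_n and zeta_n be test functions approximating psi and phi, and
    w = eta_n - zeta_n.  Since H - G is orthogonal to grad w, the norm of grad w
    is at most that of grad w - (H - G), which tends to 0; by Poincare w tends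
    to 0, whereas it tends to psi - phi. *)
Lemma dirichlet_unique (h phi psi : R * R -> R) (G H : R * R -> R * R) :
  dirichlet_solution h phi G -> dirichlet_solution h psi H ->
  psi = phi %[ae leb2 in disk].
Proof.
move=> [[[Lphi G1 G2 _] [zeta [tzeta z0 z1]]] eqG].
move=> [[[Lpsi H1 H2 _] [eta [teta e0 e1]]] eqH].
have mD := @measurable_disk R.
have L2B f g : L2 f -> L2 g -> L2 (fun x => f x - g x).
  move=> [mf +] [mg]; rewrite /L2 !L2norm_lty => fy gy.
  split; first exact: measurable_funB.
  apply: (@le_lt_trans _ _ (2%:E * (energy f + energy g))%E).
    rewrite (@eq_energy g (fun x => - g x)); last by move=> x _; rewrite sqrrN.
    by apply: energyD => //; apply: measurableT_comp => //.
  by rewrite lte_mul_pinfty// lte_add_pinfty.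
pose D x := H x - G x.
have D1 : L2 (fun x => (D x).1) by exact: L2B.
have D2 : L2 (fun x => (D x).2) by exact: L2B.
have orth eta' : test_function eta' ->
    \int[leb2]_(x in disk) dot (D x) (grad eta' x) = 0.
  move=> t; have [_ _ _ c1 c2] := test_function_C1 t.
  have iH := dot_integrable H1 H2 c1 c2.
  have iG := dot_integrable G1 G2 c1 c2.
  have := eqH _ t; rewrite -(eqG _ t) => /oppr_inj /eqP.
  rewrite -subr_eq0 -RintegralB// => /eqP <-.
  by apply: eq_Rintegral => x _; rewrite /dot /D /=; ring.
pose u x := psi x - phi x.
have Lu : L2 u by exact: L2B.
have main n : (energy u <= 2%:E * (2%:E *
    (energy (fun x => eta n x - psi x)%R + energy (fun x => zeta n x - phi x)%R) +
    4%:E * (2%:E * (energy (fun x => enorm (grad (eta n) x - H x)) +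
             energy (fun x => enorm (grad (zeta n) x - G x))))))%E.
  pose w x := eta n x - zeta n x.
  pose W x := grad (eta n) x - grad (zeta n) x.
  have Ce := test_function_C1 (teta n); have Cz := test_function_C1 (tzeta n).
  have Cw : C1 w W := C1_sub Ce Cz.
  have sw : supported w W.
    by apply: supported_sub; exact: test_function_supported.
  have [cw _ _ cW1 cW2] := Cw.
  have [ce _ _ ce1 ce2] := Ce; have [cz _ _ cz1 cz2] := Cz.
  have oW : \int[leb2]_(x in disk) dot (D x) (W x) = 0.
    have E : \int[leb2]_(x in disk)
        (dot (D x) (grad (eta n) x) - dot (D x) (grad (zeta n) x)) = 0.
      by rewrite RintegralB ?orth ?subrr//; exact: dot_integrable.
    rewrite -[RHS]E.
    by apply: eq_Rintegral => x _; rewrite /dot /D /W /=; ring.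
  have uw : energy u = energy (fun x => (w x - u x) + - w x).
    by apply: eq_energy => x _; ring.
  have wu : energy (fun x => w x - u x) =
      energy (fun x => (eta n x - psi x) + - (zeta n x - phi x)).
    by apply: eq_energy => x _; rewrite /u /w; ring.
  have eN f : energy (fun x => - f x) = energy f.
    by apply: eq_energy => x _; rewrite sqrrN.
  have [mw _] := continuous_L2 cw.
  have mN f : measurable_fun disk (f : plane -> R) -> measurable_fun disk (fun x : plane => - f x).
    by move=> mf; exact: measurableT_comp.
  have [me _] := L2B _ _ (continuous_L2 ce) Lpsi.
  have [mz _] := L2B _ _ (continuous_L2 cz) Lphi.
  have [mwu _] := L2B _ _ (continuous_L2 cw) Lu.
  rewrite uw; apply: (le_trans (energyD mwu (mN _ mw))).
  rewrite eN wu; apply: lee_wpmul2l => //; apply: leeD.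
    by apply: (le_trans (energyD me (mN _ mz))); rewrite eN.
  apply: (@le_trans _ _ (4%:E * energy (fun x => enorm (W x)))%E).
    apply: (@le_trans _ _ (4%:E * energy (fun x => (W x).1))%E).
      by rewrite (energy_Rintegral cw) (energy_Rintegral cW1) lee_fin; exact: poincare Cw sw.
    apply: lee_wpmul2l => //; apply: le_energy.
    - by have [] := continuous_L2 cW1.
    - by apply: measurable_enorm; [have [] := continuous_L2 cW1|have [] := continuous_L2 cW2].
    - by move=> x _; rewrite sqr_enorm /dot -expr2 lerDl -expr2 sqr_ge0.
  apply: lee_wpmul2l => //.
  apply: (le_trans (energy_orthogonal D1 D2 cW1 cW2 oW)).
  rewrite (@eq_energy _ (fun x => enorm ((grad (eta n) x - H x) - (grad (zeta n) x - G x)))).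
    apply: energy_enormB.
    - exact: (L2B _ _ (continuous_L2 ce1) H1).
    - exact: (L2B _ _ (continuous_L2 ce2) H2).
    - exact: (L2B _ _ (continuous_L2 cz1) G1).
    - exact: (L2B _ _ (continuous_L2 cz2) G2).
  by move=> x _; rewrite !sqr_enorm /W /D /dot /=; ring.
have u0 : energy u = 0%E.
  apply/eqP; rewrite eq_le energy_ge0 andbT; apply/lee_addgt0Pr => e e0'.
  (* [main] multiplies the four errors by 4, 4, 16 and 16. *)
  have e40 : 0 < e / 40 by rewrite divr_gt0.
  have [n [A1 A2 A3 A4]] : exists n, [/\ (energy (fun x => eta n x - psi x)%R <= (e / 40)%:E)%E,
      (energy (fun x => zeta n x - phi x)%R <= (e / 40)%:E)%E,
      (energy (fun x => enorm (grad (eta n) x - H x)) <= (e / 40)%:E)%E &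
      (energy (fun x => enorm (grad (zeta n) x - G x)) <= (e / 40)%:E)%E].
    near \oo => n; exists n; split; near: n.
    - exact: cvg_L2norm0 e0 _ e40.
    - exact: cvg_L2norm0 z0 _ e40.
    - exact: cvg_L2norm0 e1 _ e40.
    - exact: cvg_L2norm0 z1 _ e40.
  apply: (le_trans (main n)).
  have -> : (0 + e%:E = 2%:E * (2%:E * ((e / 40)%:E + (e / 40)%:E) +
     4%:E * (2%:E * ((e / 40)%:E + (e / 40)%:E))))%E.
    by rewrite add0e -!(EFinM, EFinD); congr EFin; field.
  apply: lee_wpmul2l => //; apply: leeD; apply: lee_wpmul2l => //; first exact: leeD.
  by apply: lee_wpmul2l => //; exact: leeD.
have [mu _] := Lu.
have := energy_eq0 mu u0; apply: (@filterS _ _ (ae_filter_ringOfSetsType leb2)) => x /= ux xd.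
by apply/eqP; rewrite -subr_eq0; apply/eqP; exact: ux.
Unshelve. all: by end_near. Qed.

End Uniqueness.

(** * Smooth functions vanishing on the circle belong to W^{1,2}_0 *)

Section Cutoff.
Context {R : realType}.
Implicit Types f g : R * R -> R.
#[local] Arguments enorm {R} u%_ring_scope.

(** Dominated convergence, with the same majorant rho available for several
    sequences g. *)
Lemma energy_dominated_cvg0 (g : nat -> R * R -> R) (rho : nat -> R * R -> R) (K M : R) :
  (forall n, continuous (g n)) ->
  (forall n x, disk x -> `|g n x| <= K * rho n x) ->
  (forall n x, disk x -> K * rho n x <= M) ->
  (forall x, disk x -> rho n x @[n --> \oo] --> (0 : R)) ->
  energy (g n) @[n --> \oo] --> 0%E.
Proof.
move=> cg g_rho rhoM rho0.
have mD := @measurable_disk R.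
have M2 n x : disk x -> g n x ^+ 2 <= M ^+ 2.
  move=> xd; have gM := le_trans (g_rho n x xd) (rhoM n x xd).
  by have := normr_ge0 (g n x); rewrite -(real_normK (num_real (g n x))); nra.
have [] := @dominated_convergence _ _ R leb2 disk mD
  (fun n x => (g n x ^+ 2)%:E) (cst 0%E) (cst (M ^+ 2)%:E).
- by move=> n; apply: measurable_sqr; apply: continuous_measurable_plane.
- exact: measurable_cst.
- apply: aeW => x xd; apply: cvg_EFin; first exact: nearW.
  have g0 : g n x @[n --> \oo] --> (0 : R).
    apply: (@squeeze_cvgr _ _ _ _ (fun n => - (K * rho n x)) (fun n => K * rho n x)).
    - by apply: nearW => n; rewrite -ler_norml; exact: g_rho.
    - by rewrite -[X in _ --> X]oppr0 -(mulr0 K); apply: cvgN; apply: cvgMr; exact: rho0.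
    - by rewrite -(mulr0 K); apply: cvgMr; exact: rho0.
  by rewrite -[X in _ --> X](mulr0 0); exact: (cvgM g0 g0).
- apply: (@continuous_integrable_disk _ (cst (M ^+ 2))) => x; exact: cvg_cst.
- by apply: aeW => x n xd /=; rewrite lee_fin ger0_norm ?sqr_ge0//; exact: M2.
by move=> _ _; rewrite integral0.
Qed.

(** An affine function of |x|^2, positive exactly for |x|^2 < 1 - 1/(n+1) and
    tending to +oo at each point of the open disk. *)
Definition ramp (n : nat) (x : R * R) : R := n.+1%:R * (1 - dot x x) - 1.

Definition cutoff (n : nat) (x : R * R) : R := flat 0 (ramp n x).

Lemma smooth2_dot : smooth2 (fun x : R * R => dot x x).
Proof.
by apply: smooth2_add; apply: smooth2_mul; first [exact: smooth2_fst|exact: smooth2_snd].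
Qed.

Lemma smooth2_ramp n : smooth2 (ramp n).
Proof.
rewrite (_ : ramp n = fun x => n.+1%:R * (1 + (-1) * dot x x) + (-1)).
  apply: smooth2_add; last exact: smooth2_cst.
  apply: smooth2_mul; first exact: smooth2_cst.
  apply: smooth2_add; first exact: smooth2_cst.
  by apply: smooth2_mul; [exact: smooth2_cst|exact: smooth2_dot].
by apply/funext => x; rewrite /ramp mulN1r.
Qed.

Lemma smooth1_flat_id m : smooth1 (@flat R m).
Proof. exact: (smooth1_flat m (@smooth1_id R)). Qed.

Lemma smooth2_cutoff n : smooth2 (cutoff n).
Proof. exact: smooth2_comp (smooth1_flat_id 0) (smooth2_ramp n). Qed.

Lemma is_derive_dot (x v : R * R) : is_derive x v (fun y : R * R => dot y y) (2 * dot x v).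
Proof.
have D1 := is_derive_fst x v; have D2 := is_derive_snd x v.
apply: (is_derive_eq (is_deriveD (is_deriveM D1 D1) (is_deriveM D2 D2))).
by rewrite /dot /GRing.scale/=; ring.
Qed.

Lemma is_derive_ramp n (x v : R * R) : is_derive x v (ramp n) (- (2 * n.+1%:R * dot x v)).
Proof.
have c := is_derive_cst (1 : R) x v; have cn := is_derive_cst (n.+1%:R : R) x v.
apply: (is_derive_eq (is_deriveB (is_deriveM cn (is_deriveB c (is_derive_dot x v))) c)).
by rewrite /GRing.scale/=; ring.
Qed.

Lemma is_derive_cutoff n (x v : R * R) :
  is_derive x v (cutoff n) (- (2 * n.+1%:R * dot x v) * flat 2 (ramp n x)).
Proof.
apply: (is_derive_eq (is_derive_comp_dir (is_derive_flat 0 _) (is_derive_ramp n x v))).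
by rewrite mulr0n oppr0 mul0r add0r mulrC.
Qed.

(** The support lies in the closed disk |x|^2 <= 1 - 1/(n+1). *)
Lemma test_function_cutoff f n : smooth2 f ->
  test_function (fun x => f x * cutoff n x).
Proof.
move=> sf.
have s : smooth2 (fun x => f x * cutoff n x) by exact: smooth2_mul (smooth2_cutoff n).
have cr : continuous (ramp n) := smooth2_continuous (smooth2_ramp n).
pose B : set (R * R) := ramp n @^-1` [set y | 0 <= y].
have cB : closed B.
  by apply: preimage_closed => [x _|]; [exact: cr|exact: closed_ge].
have Bd : B `<=` disk.
  move=> x; rewrite /B/= /ramp subr_ge0 => x1; apply/diskE.
  by have : (0 : R) < n.+1%:R by []; nra.
have sub : closure [set x | f x * cutoff n x != 0] `<=` B.
  rewrite closureEbigcap => x; apply; split => // y /=.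
  rewrite /B/= /cutoff leNgt; apply: contra_neqN => y0.
  by rewrite flat_le0 ?mulr0// ltW.
split.
- by move=> k; exact: smooth2_Ck.
- apply: (@subclosed_compact _ _ (square : set (R * R))).
  + exact: closed_closure.
  + by apply: compact_setX; exact: segment_compact.
  + by move=> x /sub /Bd /disk_square.
- by move=> x /sub /Bd.
Qed.

(** Besides 1 - cutoff it dominates (1 - |x|^2) |grad cutoff| up to a constant:
    with v = ramp n x one has (n+1) (1 - |x|^2) = v + 1, the derivative of
    flat 0 is flat 2, and v flat 2 v = flat 1 v. *)
Definition cutoff_error (v : R) : R := (1 - flat 0 v) + flat 1 v + flat 2 v.

Lemma flat0_le1 (v : R) : flat 0 v <= 1.
Proof. by have := flat_le 0 v; rewrite expr0. Qed.

Lemma cutoff_error_le6 v : cutoff_error v <= 6.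
Proof.
have := flat_le 1 v; have := flat_le 2 v; have := flat_ge0 0 v.
by rewrite /cutoff_error expr1 expr2; lra.
Qed.

Lemma cutoff_error_ge0 v : 0 <= cutoff_error v.
Proof.
have := flat_ge0 1 v; have := flat_ge0 2 v; have := flat0_le1 v.
by rewrite /cutoff_error; lra.
Qed.

Lemma cutoff_error_le v : 1 <= v -> cutoff_error v <= 3 / v.
Proof.
move=> v1; have v0 : 0 < v by lra.
have y0 : 0 < v^-1 by rewrite invr_gt0.
have y1 : v^-1 <= 1 by rewrite invf_le1.
rewrite /cutoff_error /flat v0 expr0 expr1 mul1r.
have := expR_ge1Dx (- v^-1).
have : expR (- v^-1) <= 1 by rewrite expR_le1 oppr_le0 ltW.
have := expR_gt0 (- v^-1).
rewrite expr2; move: (expR _) => E; move: (v^-1) y0 y1 => y y0 y1 E0 E1 Ey.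
by nra.
Qed.

Lemma cutoff_error_cvg0 x : disk x ->
  cutoff_error (ramp n x) @[n --> \oo] --> (0 : R).
Proof.
move=> /diskE x1; apply/cvgrPdist_le => e e0.
have s0 : 0 < 1 - dot x x by lra.
near=> n.
rewrite sub0r normrN ger0_norm ?cutoff_error_ge0//.
have n1 : (2 + 3 / e) / (1 - dot x x) <= n%:R by near: n; exact: nbhs_infty_ger.
have e3 : 0 < 3 / e by rewrite divr_gt0.
have v1 : 1 + 3 / e <= ramp n x.
  move: n1; rewrite ler_pdivrMr// /ramp -natr1 => n1.
  by have : 0 < (1 - dot x x) by []; nra.
apply: le_trans (cutoff_error_le _) _; first by lra.
rewrite ler_pdivrMr; last by lra.
by rewrite -ler_pdivrMl// mulrC; lra.
Unshelve. all: by end_near. Qed.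

(** In grad (f cutoff) - grad f = (cutoff - 1) grad f + f grad cutoff, the last
    term stays bounded because f vanishes at the circle at least as fast as
    grad cutoff blows up. *)
Lemma smooth2_W12_0 f C : smooth2 f ->
  (forall x, disk x -> `|f x| <= C * (1 - dot x x)) -> W12_0 f (grad f).
Proof.
move=> sf fC; have Cf := smooth2_C1 sf; split; first exact: C1_W12.
have [cf f1 f2 cf1 cf2] := Cf.
pose eta n x := f x * cutoff n x.
have se n : smooth2 (eta n) by exact: smooth2_mul (smooth2_cutoff n).
(* The bound on |f| at the centre of the disk is C itself. *)
have C0 : 0 <= C.
  have d0 : disk ((0, 0) : R * R) by apply/diskE; rewrite /dot/=; lra.
  have := le_trans (normr_ge0 _) (fC _ d0); rewrite /dot/=; lra.
have [M1 M10 fM1] := continuous_bounded_square cf1.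
have [M2 M20 fM2] := continuous_bounded_square cf2.
have fleC x : disk x -> `|f x| <= C.
  move=> xd; apply: (le_trans (fC x xd)); have := dot_ge0 x; nra.
pose Th n x := cutoff_error (ramp n x).
have rho0 x : disk x -> Th n x @[n --> \oo] --> (0 : R) by exact: cutoff_error_cvg0.
have rhoM (K : R) n x : 0 <= K -> disk x -> K * Th n x <= K * 6.
  by move=> K0 _; apply: ler_wpM2l => //; exact: cutoff_error_le6.
have chi n x : `|cutoff n x - 1| <= Th n x.
  rewrite /Th /cutoff_error /cutoff distrC ger0_norm ?subr_ge0 ?flat0_le1//.
  by rewrite -addrA lerDl addr_ge0 ?flat_ge0.
have dchi n x v : disk x -> `|dot x v| <= 1 ->
    `|f x * (- (2 * n.+1%:R * dot x v) * flat 2 (ramp n x))| <= 2 * C * Th n x.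
  move=> xd xv; have x1 := (diskE x).1 xd.
  have -> : f x * (- (2 * n.+1%:R * dot x v) * flat 2 (ramp n x)) =
    - (2 * (f x * (n.+1%:R * flat 2 (ramp n x)) * dot x v)) by ring.
  have F0 := flat_ge0 2 (ramp n x).
  rewrite normrN normrM ger0_norm// -[leRHS]mulrA ler_wpM2l// normrM.
  apply: (@le_trans _ _ (`|f x * (n.+1%:R * flat 2 (ramp n x))|)).
    by rewrite ler_piMr.
  rewrite normrM (ger0_norm (mulr_ge0 _ F0))//.
  apply: (@le_trans _ _ (C * (1 - dot x x) * (n.+1%:R * flat 2 (ramp n x)))).
    by rewrite ler_wpM2r ?mulr_ge0//; exact: fC.
  have -> : C * (1 - dot x x) * (n.+1%:R * flat 2 (ramp n x)) =
      C * ((ramp n x + 1) * flat 2 (ramp n x)) by rewrite /ramp; ring.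
  rewrite ler_wpM2l// mulrDl -flatS mul1r /Th /cutoff_error.
  by have := flat0_le1 (ramp n x); lra.
have dE n (x v : R * R) df : is_derive x v f df ->
   'D_v (eta n) x = f x * (- (2 * n.+1%:R * dot x v) * flat 2 (ramp n x)) + cutoff n x * df.
  move=> D; have F := is_deriveM D (is_derive_cutoff n x v).
  by rewrite (@derive_val _ _ _ _ _ _ _ F).
have Deta n := smooth2_C1 (se n).
have W n x : disk x ->
    `|enorm (grad (eta n) x - grad f x)| <= (2 * C * 2 + M1 + M2) * Th n x.
  move=> xd; rewrite ger0_norm ?sqrtr_ge0//.
  have [x1 x2 x3 x4] := disk_coord xd.
  have T0 := cutoff_error_ge0 (ramp n x); rewrite -/(Th n x) in T0.
  have c1 : `|(grad (eta n) x - grad f x).1| <= (2 * C + M1) * Th n x.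
    have -> : (grad (eta n) x - grad f x).1 =
        f x * (- (2 * n.+1%:R * dot x (1, 0)) * flat 2 (ramp n x)) +
        (cutoff n x - 1) * (grad f x).1.
      transitivity ('D_((1, 0) : R * R) (eta n) x - (grad f x).1) => //.
      by rewrite (dE _ _ _ _ (f1 x)); ring.
    apply: (le_trans (ler_normD _ _)); rewrite [leRHS]mulrDl; apply: lerD.
      apply: dchi => //; rewrite /dot/= mulr1 mulr0 addr0 ler_norml.
      by rewrite !ltW.
    rewrite normrM [leRHS]mulrC; apply: ler_pM => //.
    exact: fM1 (disk_square xd).
  have c2 : `|(grad (eta n) x - grad f x).2| <= (2 * C + M2) * Th n x.
    have -> : (grad (eta n) x - grad f x).2 =
        f x * (- (2 * n.+1%:R * dot x (0, 1)) * flat 2 (ramp n x)) +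
        (cutoff n x - 1) * (grad f x).2.
      transitivity ('D_((0, 1) : R * R) (eta n) x - (grad f x).2) => //.
      by rewrite (dE _ _ _ _ (f2 x)); ring.
    apply: (le_trans (ler_normD _ _)); rewrite [leRHS]mulrDl; apply: lerD.
      apply: dchi => //; rewrite /dot/= mulr1 mulr0 add0r ler_norml.
      by rewrite !ltW.
    rewrite normrM [leRHS]mulrC; apply: ler_pM => //.
    exact: fM2 (disk_square xd).
  apply: (@le_trans _ _ (`|(grad (eta n) x - grad f x).1| + `|(grad (eta n) x - grad f x).2|)).
    move: (_ - _) => w.
    rewrite -(ler_pXn2r (ltn0Sn 1)) ?nnegrE ?addr_ge0 ?sqrtr_ge0// sqr_enorm.
    rewrite sqrrD !real_normK ?num_real// /dot -!expr2.
    by rewrite -addrA lerD2l lerDr mulrn_wge0// mulr_ge0.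
  by apply: (le_trans (lerD c1 c2)); rewrite le_eqVlt; apply/orP; left; apply/eqP; ring.
exists eta; split.
- by move=> n; exact: test_function_cutoff.
- apply: energy_cvg0; apply: (@energy_dominated_cvg0 _ Th C (C * 6)) => //.
  + move=> n x; apply: cvgB; [exact: smooth2_continuous|exact: cf].
  + move=> n x xd; rewrite /eta -[X in _ - X]mulr1 -mulrBr normrM.
    by apply: ler_pM => //; exact: fleC.
  + by move=> n x; exact: rhoM.
- apply: energy_cvg0.
  apply: (@energy_dominated_cvg0 _ Th (2 * C * 2 + M1 + M2) ((2 * C * 2 + M1 + M2) * 6)) => //.
  + move=> n; have [_ _ _ d1 d2] := Deta n.
    apply: continuous_enorm => x; apply: cvgB.
    * exact: d1.
    * exact: cf1.
    * exact: d2.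
    * exact: cf2.
  + by move=> n x; apply: rhoM; lra.
Qed.

End Cutoff.

(** * The radial profiles *)

Section Profile.
Context {R : realType}.

(** A smooth positive function equal to t for t >= 1.  With v = 1 - t > 0 it is
    1 - v (1 - exp(-1/v)), which is positive since 1 - exp(-1/v) < 1/v; the
    factor 1 - t is what keeps it positive for negative t as well. *)
Definition denom (t : R) : R := t + (1 - t) * flat 0 (1 - t).
Definition denom1 (t : R) : R := 1 - flat 0 (1 - t) - flat 1 (1 - t).
Definition denom2 (t : R) : R := flat 3 (1 - t).

Lemma denom_gt0 t : 0 < denom t.
Proof.
rewrite /denom; have [t1|t1] := leP 1 t; first by rewrite flat_le0; lra.
have v0 : 0 < 1 - t by lra.
rewrite /flat v0 expr0 mul1r.
set v := 1 - t in v0 *; have -> : t = 1 - v by rewrite /v; ring.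
have y0 : - v^-1 != 0 by rewrite oppr_eq0 invr_eq0 gt_eqF.
have := expR_gt1Dx y0; rewrite -(ltr_pM2l v0) mulrDr mulr1 mulrN mulfV ?gt_eqF//.
lra.
Qed.

Lemma denom_neq0 t : denom t != 0. Proof. by rewrite gt_eqF// denom_gt0. Qed.

Lemma is_derive_onem (t : R) : is_derive t 1 (fun t : R => 1 - t) (-1).
Proof.
by apply: (is_derive_eq (is_deriveB (is_derive_cst (1 : R) t (1 : R)) (is_derive_id t (1 : R)))); rewrite sub0r.
Qed.

Lemma is_derive_flat_onem m (t : R) :
  is_derive t 1 (fun t => flat m (1 - t)) (m%:R * flat m.+1 (1 - t) - flat m.+2 (1 - t)).
Proof.
apply: (is_derive_eq (is_derive_comp_dir (is_derive_flat m _) (is_derive_onem t))).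
by ring.
Qed.

Lemma is_derive_denom (t : R) : is_derive t 1 denom (denom1 t).
Proof.
apply: (is_derive_eq (is_deriveD (is_derive_id t (1 : R))
  (is_deriveM (is_derive_onem t) (is_derive_flat_onem 0 t)))).
rewrite /denom1 /GRing.scale/= [flat 1 _]flatS mulr0n; ring.
Qed.

Lemma is_derive_denom1 (t : R) : is_derive t 1 denom1 (denom2 t).
Proof.
apply: (is_derive_eq (is_deriveB (is_deriveB (is_derive_cst (1 : R) t (1 : R))
  (is_derive_flat_onem 0 t)) (is_derive_flat_onem 1 t))).
rewrite /denom2 mulr0n; ring.
Qed.

(** Smooth everywhere and equal to 1/t for t >= 1, so that
    profile (L |x|^2) x_1 is a multiple of the dipole x_1 / |x|^2 away from the
    origin.  Its first two derivatives are profile1 and profile2. *)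
Definition profile (t : R) : R := (denom t)^-1.
Definition profile1 (t : R) : R := (-1) * (denom1 t * ((denom t)^-1 * (denom t)^-1)).
Definition profile2 (t : R) : R :=
  2 * (denom1 t * denom1 t * ((denom t)^-1 * ((denom t)^-1 * (denom t)^-1))) +
  (-1) * (denom2 t * ((denom t)^-1 * (denom t)^-1)).
(** The Laplacian of profile (L |x|^2) x_1 is 2 L x_1 source (L |x|^2). *)
Definition source (t : R) : R := 2 * (t * profile2 t) + 4 * profile1 t.

Lemma is_derive_profile (t : R) : is_derive t 1 profile (profile1 t).
Proof.
apply: (is_derive_eq (is_deriveV (denom_neq0 t) (is_derive_denom t))).
by rewrite /profile1 /GRing.scale/=; field; exact: denom_neq0.
Qed.

Lemma is_derive_profile1 (t : R) : is_derive t 1 profile1 (profile2 t).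
Proof.
have c := is_derive_cst (-1 : R) t 1.
apply: (is_derive_eq (is_deriveM c (is_deriveM (is_derive_denom1 t)
  (is_deriveM (is_derive_profile t) (is_derive_profile t))))).
by rewrite !mulrfctE /profile1 /profile2 /profile /GRing.scale/=; field; exact: denom_neq0.
Qed.

Lemma smooth1_onem : smooth1 (fun t : R => 1 - t).
Proof.
rewrite (_ : (fun _ => _) = (fun t : R => 1 + (-1) * t)).
  apply: smooth1_add; first exact: smooth1_cst.
  by apply: smooth1_mul; [exact: smooth1_cst|exact: smooth1_id].
by apply/funext => t; rewrite mulN1r.
Qed.

Lemma smooth1_flat_onem m : smooth1 (fun t : R => flat m (1 - t)).
Proof. exact: smooth1_flat smooth1_onem. Qed.

Lemma smooth1_denom : smooth1 denom.
Proof.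
apply: smooth1_add; first exact: smooth1_id.
by apply: smooth1_mul; [exact: smooth1_onem|exact: smooth1_flat_onem].
Qed.

Lemma smooth1_denom1 : smooth1 denom1.
Proof.
rewrite (_ : denom1 = (fun t : R => 1 + (-1) * flat 0 (1 - t) + (-1) * flat 1 (1 - t))).
  do 2 (apply: smooth1_add; last by
    apply: smooth1_mul; [exact: smooth1_cst|exact: smooth1_flat_onem]).
  exact: smooth1_cst.
by apply/funext => t; rewrite !mulN1r.
Qed.

Lemma smooth1_profile : smooth1 profile.
Proof. exact: smooth1_inv denom_neq0 smooth1_denom. Qed.

Lemma smooth1_profile1 : smooth1 profile1.
Proof.
have sg := smooth1_profile; have s1 := smooth1_denom1; have sc := @smooth1_cst R.
by do ![apply: smooth1_mul].
Qed.

Lemma smooth1_profile2 : smooth1 profile2.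
Proof.
have sg := smooth1_profile; have s1 := smooth1_denom1; have sc := @smooth1_cst R.
have s2 : smooth1 denom2 by exact: smooth1_flat_onem.
by apply: smooth1_add; do ![apply: smooth1_mul].
Qed.

Lemma smooth1_source : smooth1 source.
Proof.
have sg1 := smooth1_profile1; have sg2 := smooth1_profile2; have sc := @smooth1_cst R.
have sid := @smooth1_id R.
by apply: smooth1_add; do ?[assumption | exact: sc | apply: smooth1_mul].
Qed.

(** Here source vanishes because the dipole x_1 / |x|^2 is harmonic. *)
Lemma profile_ge1 t : 1 <= t -> [/\ profile t = t^-1, profile1 t = - t^-2 & source t = 0].
Proof.
move=> t1; have t0 : t != 0 by rewrite gt_eqF//; lra.
have v0 : 1 - t <= 0 by lra.
rewrite /source /profile2 /profile1 /profile /denom /denom1 /denom2 !flat_le0// mulr0 addr0 !subr0.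
by split => //; field.
Qed.

(** Prevents b from being constant, which would make the denominator of the
    quotient vanish. *)
Lemma source0_neq0 : source 0 != 0.
Proof.
have e2 : 2 < expR 1 :> R by have := @expR_gt1Dx R 1 (oner_neq0 R); lra.
have e0 : 0 < (expR 1 : R)^-1 by rewrite invr_gt0 expR_gt0.
have e1 : (expR 1 : R)^-1 < 2^-1 by rewrite ltf_pV2 ?posrE ?expR_gt0.
have n1 : denom1 0 != 0.
  rewrite /denom1 /flat subr0 ltr01 invr1 !expr1n !mul1r expRN.
  by rewrite gt_eqF//; lra.
rewrite /source mul0r mulr0 add0r /profile1 mulN1r mulrN oppr_eq0.
by rewrite !mulf_eq0 pnatr_eq0/= (negbTE n1) !invr_eq0 !(negbTE (denom_neq0 _)).
Qed.

Lemma smooth1_bounded (u : R -> R) : smooth1 u ->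
  exists2 C : R, 0 <= C & forall t : R, 0 <= t <= 1 -> `|u t| <= C.
Proof.
move=> /smooth1_continuous cu.
have cu' : continuous (fun t => `|u t|).
  by move=> t; apply: continuous_comp; [exact: cu|exact: norm_continuous].
have [c _ Hc] := @EVT_max R _ 0 1 ler01 (continuous_subspaceT cu').
by exists `|u c| => // t t01; apply: Hc; rewrite in_itv.
Qed.

(** The constant C does not depend on the scale; this is what makes the bound
    on grad b below uniform. *)
Lemma source_derive : exists (source1 : R -> R) (C : R), [/\ smooth1 source1,
  forall t : R, is_derive t 1 source (source1 t),
  0 < C,
  forall t : R, 0 <= t <= 1 -> `|source t| <= C /\ `|source1 t| <= C &
  forall t : R, 1 < t -> source t = 0 /\ source1 t = 0].
Proof.
have [source1 sk' Dk] := smooth1_derive smooth1_source.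
have [C1 C10 kC1] := smooth1_bounded smooth1_source.
have [C2 C20 kC2] := smooth1_bounded sk'.
exists source1, (C1 + C2 + 1); split => //.
- by rewrite ltr_pwDr// addr_ge0.
- move=> t t01; split.
    by apply: le_trans (kC1 t t01) _; lra.
  by apply: le_trans (kC2 t t01) _; lra.
- move=> t t1; have [_ _ k0] := profile_ge1 (ltW t1); split => //.
  have near0 : \near t, source t = cst 0 t.
    near=> y; have y1 : 1 <= y by apply: ltW; near: y; exact: lt_nbhsr.
    by have [_ _ ->] := profile_ge1 y1.
  have D := near_eq_is_derive near0 (Dk t).
  by rewrite -(@derive_val _ _ _ _ _ _ _ D) derive_cst.
Unshelve. all: by end_near. Qed.

(** A C^1 profile with slope -1 on t <= 1, where source lives, and constant for
    t >= 2: as a function of L |x|^2 its energy is independent of L. *)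
Definition height (t : R) : R := 2^-1 * (sqpos (2 - t) - sqpos (1 - t)).
Definition height1 (t : R) : R := Num.max (1 - t) 0 - Num.max (2 - t) 0.

Lemma is_derive_height (t : R) : is_derive t 1 height (height1 t).
Proof.
have c := is_derive_cst (2^-1 : R) t 1.
have D (a : R) : is_derive t 1 (fun t => sqpos (a - t)) (- (2 * Num.max (a - t) 0)).
  have Da := is_deriveB (is_derive_cst a t 1) (is_derive_id t (1 : R)).
  by apply: (is_derive_eq (is_derive_comp_dir (is_derive_sqpos _) Da)); rewrite sub0r mulrN1.
apply: (is_derive_eq (is_deriveM c (is_deriveB (D 2) (D 1)))).
by rewrite /height1 /GRing.scale/=; field.
Qed.

Lemma height1_continuous : continuous height1.
Proof.
have M (a : R) : continuous (fun t : R => Num.max (a - t) 0).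
  move=> t; have ca : {for t, continuous (fun t : R => a - t)}.
    by apply: cvgB; [exact: cvg_cst|exact: cvg_id].
  exact: (@continuous_max R R _ (cst 0) t ca (@cst_continuous _ _ 0 _)).
by move=> t; apply: cvgB; exact: M.
Qed.

Lemma height1_le1 t : t <= 1 -> height1 t = -1.
Proof.
by move=> t1; rewrite /height1; case: (leP (1 - t) 0) => ?; case: (leP (2 - t) 0) => ?; lra.
Qed.

Lemma height1_ge2 t : 2 <= t -> height1 t = 0.
Proof.
by move=> t1; rewrite /height1; case: (leP (1 - t) 0) => ?; case: (leP (2 - t) 0) => ?; lra.
Qed.

Lemma height1_norm t : `|height1 t| <= 1.
Proof.
rewrite /height1 ler_norml.
by case: (leP (1 - t) 0) => ?; case: (leP (2 - t) 0) => ?; apply/andP; split; lra.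
Qed.

End Profile.

(** * The concentrated solutions *)

Section Radial.
Context {R : realType}.
Implicit Types (f : R * R -> R) (G : R * R -> R * R).

Lemma C1_radial (L : R) (u u' : R -> R) :
  (forall t : R, is_derive t 1 u (u' t)) -> continuous u' ->
  C1 (fun x => u (L * dot x x))
     (fun x => (u' (L * dot x x) * (2 * L * x.1), u' (L * dot x x) * (2 * L * x.2))).
Proof.
move=> Du cu'.
have cu : continuous u.
  move=> t; apply: differentiable_continuous; apply/derivable1_diffP.
  exact: (@ex_derive _ _ _ _ _ _ _ (Du t)).
have sS : smooth2 (fun x : R * R => L * dot x x).
  by apply: smooth2_mul; [exact: smooth2_cst|exact: smooth2_dot].
have cS := smooth2_continuous sS.
have DS (x v : R * R) : is_derive x v (fun x : R * R => L * dot x x) (2 * L * dot x v).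
  apply: (is_derive_eq (is_deriveM (is_derive_cst L x v) (is_derive_dot x v))).
  by rewrite /GRing.scale/=; ring.
have c1 : continuous (fun x : R * R => 2 * L * x.1).
  apply: smooth2_continuous; apply: smooth2_mul; [exact: smooth2_cst|exact: smooth2_fst].
have c2 : continuous (fun x : R * R => 2 * L * x.2).
  apply: smooth2_continuous; apply: smooth2_mul; [exact: smooth2_cst|exact: smooth2_snd].
have cc (w : R -> R) : continuous w -> continuous (fun x => w (L * dot x x)).
  by move=> cw x; apply: (@continuous_comp _ _ _ (fun x => L * dot x x) w);
    [exact: cS|exact: cw].
split.
- exact: cc.
- move=> x; apply: (is_derive_eq (is_derive_comp_dir (Du _) (DS x _))).
  by rewrite /dot/=; ring.
- move=> x; apply: (is_derive_eq (is_derive_comp_dir (Du _) (DS x _))).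
  by rewrite /dot/=; ring.
- by apply: continuous_mulf => //; exact: cc.
- by apply: continuous_mulf => //; exact: cc.
Qed.

(** Integration by parts in each component of the gradient. *)
Lemma weak_poisson f G H1 H2 (h : R * R -> R) : C1 f G ->
  C1 (fun x => (G x).1) H1 -> C1 (fun x => (G x).2) H2 ->
  (forall x, h x = (H1 x).1 + (H2 x).2) ->
  forall eta, test_function eta ->
    - (\int[leb2]_(x in disk) dot (G x) (grad eta x)) =
      \int[leb2]_(x in disk) (h x * eta x).
Proof.
move=> Cf C1' C2' hE eta teta.
have Ce := test_function_C1 teta; have se := test_function_supported teta.
have [E1 _] := integration_by_parts_disk C1' Ce se.
have [_ E2] := integration_by_parts_disk C2' Ce se.
have [cf _ _ cG1 cG2] := Cf; have [ce _ _ ce1 ce2] := Ce.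
have [_ _ _ cH1 _] := C1'; have [_ _ _ _ cH2] := C2'.
have mD := @measurable_disk R.
rewrite /dot RintegralD//; [|apply: continuous_integrable_disk; exact: continuous_mulf..].
rewrite E1 E2 -opprD opprK -RintegralD//;
  [|apply: continuous_integrable_disk; exact: continuous_mulf..].
by apply: eq_Rintegral => x _; rewrite hE mulrDl.
Qed.

End Radial.

Section Family.
Context {R : realType}.
Variables (L : R) (source1 : R -> R).
Hypothesis smooth_source1 : smooth1 source1.
Hypothesis Dsource : forall t : R, is_derive t 1 source (source1 t).
Hypothesis source_out : forall t, 1 < t -> source t = 0 /\ source1 t = 0.

Local Notation S x := (L * dot x x).

Definition amplitude (t : R) : R := L * profile t - 1.

Definition wente_phi (x : R * R) : R := amplitude (S x) * x.1.
Definition grad_phi (x : R * R) : R * R :=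
  (amplitude (S x) + 2 * L * (L * profile1 (S x)) * (x.1 * x.1),
   2 * L * (L * profile1 (S x)) * (x.1 * x.2)).
Definition wente_a (x : R * R) : R := height (S x).
Definition grad_a (x : R * R) : R * R :=
  (height1 (S x) * (2 * L * x.1), height1 (S x) * (2 * L * x.2)).
(** The factor source makes b supported in L |x|^2 <= 1. *)
Definition wente_b (x : R * R) : R := (- L * source (S x)) * x.2.
Definition grad_b (x : R * R) : R * R :=
  (- L * (source1 (S x) * (2 * L * x.1)) * x.2,
   - L * (source1 (S x) * (2 * L * x.2)) * x.2 - L * source (S x)).

Lemma C1_wente_a : C1 wente_a grad_a.
Proof. by apply: C1_radial; [exact: is_derive_height|exact: height1_continuous]. Qed.

Lemma is_deriveZ_R (c : R) (w w' : R -> R) : (forall t : R, is_derive t 1 w (w' t)) ->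
  forall t : R, is_derive t 1 (fun t => c * w t) (c * w' t).
Proof.
move=> Dw t; apply: (is_derive_eq (is_deriveM (is_derive_cst c t 1) (Dw t))).
by rewrite /GRing.scale/= mulr0 addr0.
Qed.

Lemma continuousZ_R (c : R) (w : R -> R) : continuous w -> continuous (fun t => c * w t).
Proof. by move=> cw t; apply: cvgM; [exact: cvg_cst|exact: cw]. Qed.
Arguments continuousZ_R c {w} cw.
Arguments is_deriveZ_R c {w w'} Dw.

Lemma C1_wente_b : C1 wente_b grad_b.
Proof.
refine (eq_C1 (C1_mul (C1_radial L (is_deriveZ_R (- L) Dsource)
  (continuousZ_R (- L) (smooth1_continuous smooth_source1))) C1_snd) _).
by move=> x; rewrite /grad_b/=; congr pair; ring.
Qed.

Lemma is_derive_amplitude (t : R) : is_derive t 1 amplitude (L * profile1 t).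
Proof.
apply: (is_derive_eq (is_deriveB (is_deriveZ_R L (@is_derive_profile R) t) (is_derive_cst (1 : R) t 1))).
by rewrite subr0.
Qed.

Lemma C1_wente_phi : C1 wente_phi grad_phi.
Proof.
apply: (eq_C1 (C1_mul (C1_radial L is_derive_amplitude
  (continuousZ_R L (smooth1_continuous (@smooth1_profile1 R)))) C1_fst)).
by move=> x; rewrite /grad_phi/=; congr pair; ring.
Qed.

Lemma smooth2_wente_phi : smooth2 wente_phi.
Proof.
apply: smooth2_mul; last exact: smooth2_fst.
apply: (@smooth2_comp _ amplitude).
  apply: smooth1_add; last exact: smooth1_cst.
  by apply: smooth1_mul; [exact: smooth1_cst|exact: smooth1_profile].
by apply: smooth2_mul; [exact: smooth2_cst|exact: smooth2_dot].
Qed.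

(** Only the derivative of b along the circles centred at 0 contributes, and on
    the support of source the slope height1 equals -1. *)
Lemma jacobian_wente x : jacobian_det grad_a grad_b x = 2 * L ^+ 2 * x.1 * source (S x).
Proof.
rewrite /jacobian_det /dot /perp /=.
have [S1|S1] := leP (S x) 1.
  by rewrite height1_le1//; ring.
by have [-> ->] := source_out S1; ring.
Qed.

Lemma wente_phi_weak : forall eta, test_function eta ->
    - (\int[leb2]_(x in disk) dot (grad_phi x) (grad eta x)) =
      \int[leb2]_(x in disk) (jacobian_det grad_a grad_b x * eta x).
Proof.
have C1u1 := C1_radial L (is_deriveZ_R (2 * L) (is_deriveZ_R L (@is_derive_profile1 R)))
  (continuousZ_R (2 * L) (continuousZ_R L (smooth1_continuous (@smooth1_profile2 R)))).
apply: (weak_poisson C1_wente_phi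
  (C1_add (C1_radial L is_derive_amplitude (continuousZ_R L (smooth1_continuous (@smooth1_profile1 R))))
    (C1_mul C1u1 (C1_mul C1_fst C1_fst)))
  (C1_mul C1u1 (C1_mul C1_fst C1_snd))).
move=> x; rewrite jacobian_wente /source /=; rewrite /dot; ring.
Qed.

(** For L |x|^2 >= 1 the amplitude is (1 - |x|^2) / |x|^2; for smaller |x| the
    factor 1 - |x|^2 is at least 1/2. *)
Lemma wente_phi_boundary : 2 <= L -> exists C : R, forall x, disk x -> `|wente_phi x| <= C * (1 - dot x x).
Proof.
move=> L2; have [Cg Cg0 gC] := smooth1_bounded (@smooth1_profile R).
exists (L + 2 * (L * Cg + 1)) => x xd; have x1 := (diskE x).1 xd.
have s0 := dot_ge0 x.
have [y1 y2 _ _] := disk_coord xd.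
have L0 : 0 <= L by lra.
have LC0 : 0 <= L * Cg by exact: mulr_ge0.
rewrite /wente_phi normrM; apply: (@le_trans _ _ `|amplitude (S x)|).
  by rewrite ler_piMr// ler_norml !ltW.
have [S1|S1] := leP 1 (S x).
  have sp : 0 < dot x x by rewrite lt_neqAle s0 andbT; apply: contraTneq S1 => <-; rewrite mulr0 -ltNge.
  have Ln0 : L != 0 by rewrite gt_eqF//; lra.
  have [gE _ _] := profile_ge1 S1; rewrite /amplitude gE.
  have -> : L * (S x)^-1 - 1 = (1 - dot x x) * (dot x x)^-1.
    by field; rewrite Ln0 gt_eqF.
  have p1 : 0 <= 1 - dot x x by rewrite subr_ge0 ltW.
  rewrite normrM ger0_norm// mulrC; apply: ler_wpM2r => //.
  rewrite gtr0_norm ?invr_gt0//; apply: (@le_trans _ _ L); last by lra.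
  by rewrite -[leLHS]mul1r ler_pdivrMr.
have gx : `|profile (S x)| <= Cg by apply: gC; rewrite (ltW S1) andbT mulr_ge0//; lra.
apply: (@le_trans _ _ (L * Cg + 1)).
  apply: (le_trans (ler_normB _ _)); rewrite normr1 lerD2r normrM ger0_norm; last by lra.
  by apply: ler_wpM2l => //; lra.
have : dot x x <= 2^-1 by nra.
by nra.
Qed.

Lemma wente_phi_dirichlet : 2 <= L -> the_dirichlet_solution (jacobian_det grad_a grad_b) wente_phi grad_phi.
Proof.
move=> L2; have sol : dirichlet_solution (jacobian_det grad_a grad_b) wente_phi grad_phi.
  split; last exact: wente_phi_weak.
  have [C phiC] := wente_phi_boundary L2.
  by have := smooth2_W12_0 smooth2_wente_phi phiC; rewrite (C1_grad C1_wente_phi).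
split => // psi H; exact: (dirichlet_unique sol).
Qed.

End Family.

(** * Bounding squared norms by areas of boxes *)

Section Boxes.
Context {R : realType}.
Local Notation plane := (measurableTypeR R * measurableTypeR R)%type.
Implicit Types (f : R * R -> R).

Lemma energy_le_box f (M r : R) : measurable_fun disk (f : plane -> R) ->
  0 <= M -> 0 <= r -> (forall x, disk x -> f x ^+ 2 <= M) ->
  (forall x, disk x -> f x != 0 -> `|x.1| <= r /\ `|x.2| <= r) ->
  (energy f <= (M * (2 * r) ^+ 2)%:E)%E.
Proof.
move=> mf M0 r0 fM fr.
pose B : set plane := `[(- r), r] `*` `[(- r), r].
have mB : measurable B by apply: measurableX; exact: measurable_itv.
have mD := @measurable_disk R.
have m1 : measurable_fun disk (EFin \o (\1_B : plane -> R)).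
  by apply/measurable_EFinP; exact: measurable_indic.
apply: (@le_trans _ _ (\int[leb2]_(x in disk) (M%:E * (EFin \o (\1_B : plane -> R)) x))%E).
  apply: ge0_le_integral => //.
  - by move=> x _; rewrite lee_fin sqr_ge0.
  - exact: measurable_sqr.
  - exact: emeasurable_funM.
  - move=> x xd /=; rewrite -EFinM lee_fin.
    have [->|fx] := eqVneq (f x) 0; first by rewrite expr0n/= mulr_ge0.
    have [x1 x2] := fr x xd fx.
    rewrite indicE mem_set ?mulr1; first exact: fM.
    by split; rewrite /= in_itv/= -ler_norml.
rewrite ge0_integralZl_EFin//; last by move=> x _; rewrite lee_fin.
rewrite [X in (_ * X)%E](integral_indic leb2 mD mB) EFinM lee_wpmul2l//.
apply: (@le_trans _ _ (leb2 B)).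
  by apply: le_measure; rewrite ?inE//; exact: measurableI.
by rewrite leb2_box; [|lra|lra]; rewrite lee_fin le_eqVlt; apply/orP; left; apply/eqP; ring.
Qed.

Lemma energy_ge_boxes f (c : nat -> R) (Q : nat -> set plane) (m : nat) :
  measurable_fun disk (f : plane -> R) ->
  (forall i, measurable (Q i)) -> (forall i, Q i `<=` disk) -> trivIset setT Q ->
  (forall i, 0 <= c i) ->
  (forall i x, (i < m)%N -> Q i x -> c i <= f x ^+ 2) ->
  (\sum_(i < m) (c i)%:E * leb2 (Q i) <= energy f)%E.
Proof.
move=> mf mQ Qd tQ c0 cf.
have mD := @measurable_disk R.
have msub (A : set plane) : A `<=` disk ->
    measurable_fun A (EFin \o (fun x => f x ^+ 2) : plane -> \bar R).
  by move=> Ad; apply: (measurable_funS mD Ad); exact: measurable_sqr.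
pose D := \big[setU/set0]_(i <- index_iota 0 m) Q i.
have mDQ : measurable D by exact: bigsetU_measurable.
have DQ : D `<=` disk.
  by rewrite /D -bigcup_seq => x [i _] /Qd.
apply: (@le_trans _ _ (\int[leb2]_(x in D) (f x ^+ 2)%:E)%E).
  rewrite ge0_integral_bigsetU//.
  - rewrite big_mkord; apply: lee_sum => i _.
    rewrite -integral_cst//; apply: ge0_le_integral => //.
    + by move=> x _; rewrite lee_fin.
    + exact: msub (Qd i).
    + by move=> x Qx; rewrite lee_fin; exact: cf.
  - exact: iota_uniq.
  - exact: sub_trivIset tQ.
  - exact: msub.
  - by move=> x _; rewrite lee_fin sqr_ge0.
apply: ge0_subset_integral => //; first exact: measurable_sqr.
by move=> x _; rewrite lee_fin sqr_ge0.
Qed.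

(** A function of zero energy vanishes almost everywhere, but a box has positive
    area. *)
Lemma energy_neq0 f (a b : R) : measurable_fun disk (f : plane -> R) -> a < b ->
  (forall x1 x2 : R, a <= x1 <= b -> a <= x2 <= b -> disk (x1, x2) /\ f (x1, x2) != 0) ->
  energy f != 0%E.
Proof.
move=> mf ab fx; apply/eqP => /(energy_eq0 mf).
pose B : set plane := `[a, b] `*` `[a, b].
have mB : measurable B by apply: measurableX; exact: measurable_itv.
move=> [A [mA A0 subA]].
have BA : B `<=` A.
  move=> [x1 x2] [/=]; rewrite !in_itv/= => h1 h2.
  have [d12 f12] := fx _ _ h1 h2.
  by apply: subA => /= H; move: f12; rewrite (H d12) eqxx.
have : (leb2 B <= leb2 A)%E by apply: le_measure; rewrite ?inE.
rewrite A0 leb2_box ?(ltW ab)// lee_fin leNgt => /negP; apply.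
by rewrite mulr_gt0 ?subr_gt0.
Qed.

End Boxes.

(** * Estimates for the concentrated solutions *)

Section Estimates.
Context {R : realType}.
Local Notation plane := (measurableTypeR R * measurableTypeR R)%type.

Lemma enorm_prod_sqr (w : R) (G : R * R) : (w * enorm G) ^+ 2 = w ^+ 2 * dot G G.
Proof. by rewrite exprMn sqr_enorm. Qed.

Lemma C1_measurable_enorm (f : R * R -> R) G : C1 f G ->
  measurable_fun disk (fun x : plane => enorm (G x)).
Proof.
move=> [_ _ _ c1 c2]; have [m1 _] := continuous_L2 c1; have [m2 _] := continuous_L2 c2.
exact: measurable_enorm.
Qed.

Lemma disk_enorm_measurable : measurable_fun disk (fun x : plane => enorm (x : R * R)).
Proof.
have [+ _] := continuous_L2 (@continuous_enorm R id (fun x => cvg_fst) (fun x => cvg_snd)).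
exact.
Qed.

Lemma coord_le (r : R) (x : R * R) : 0 <= r -> dot x x <= r ^+ 2 -> `|x.1| <= r /\ `|x.2| <= r.
Proof.
case: x => x1 x2; rewrite /dot/= => r0 xr.
have s1 := sqr_ge0 x1; have s2 := sqr_ge0 x2; rewrite !expr2 in s1 s2 xr.
by split; rewrite ler_norml; apply/andP; split; nra.
Qed.

Variable m : nat.
Let l : R := 2 ^+ m.+1.
Let L : R := l ^+ 2.

Lemma l_gt0 : 0 < l. Proof. exact: exprn_gt0. Qed.

Lemma l_ge2 : 2 <= l.
Proof. by rewrite /l exprS ler_peMr// exprn_ege1// ler1n. Qed.

(** |grad a|^2 <= 8 L on a set contained in a square of area 16 / L. *)
Lemma energy_grad_a : (energy (fun x => 1 * enorm (grad_a L x))%R <= 128%:E)%E.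
Proof.
have l0 := l_gt0.
have L0 : 0 < L by rewrite exprn_gt0.
have -> : (128 : R) = 8 * L * (2 * (2 / l)) ^+ 2.
  by rewrite /L; field; rewrite gt_eqF.
have fE x : (1 * enorm (grad_a L x)) ^+ 2 = 4 * L * (height1 (L * dot x x) ^+ 2 * (L * dot x x)).
  by rewrite enorm_prod_sqr /grad_a {1}/dot /= /dot; ring.
have S0 (x : R * R) : 0 <= L * dot x x by rewrite mulr_ge0 ?dot_ge0// ltW.
apply: energy_le_box.
- under eq_fun do rewrite mul1r.
  exact: C1_measurable_enorm (C1_wente_a L).
- by rewrite mulr_ge0// ltW.
- by rewrite divr_ge0// ltW.
- move=> x _; rewrite fE.
  have -> : 8 * L = 4 * L * 2 by ring.
  apply: ler_wpM2l; first by rewrite mulr_ge0// ltW.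
  have [S2|S2] := leP (L * dot x x) 2; last by rewrite height1_ge2 ?(ltW S2)// expr0n/= mul0r.
  rewrite -[leRHS]mul1r; apply: ler_pM => //; first exact: sqr_ge0.
  by have := height1_norm (L * dot x x); rewrite ler_norml => /andP[? ?]; nra.
- move=> x _ f0; apply: coord_le => //; first by rewrite divr_ge0// ltW.
  have S2 : L * dot x x < 2.
    rewrite ltNge; apply: contra_neqN f0 => S2.
    apply/eqP; rewrite -sqrf_eq0 fE height1_ge2// expr0n/= mul0r mulr0//.
  rewrite exprMn exprVn ler_pdivlMr// mulrC; apply: le_trans (ltW S2) _.
  by rewrite expr2; lra.
Qed.

(** Each of the m squares ]2^-(i+2), 2^-(i+1)]^2 lies in the region
    1 <= L |x|^2, |x|^2 <= 1/2, where
    |x|^2 |grad phi|^2 >= (1 - |x|^2)^2 / |x|^2 >= 1 / (4 |x|^2).  On the square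
    of side h/2 next to the corner (h, h) this is at least 1 / (8 h^2), while
    the area is h^2 / 4: its contribution is at least 1/32. *)
Lemma energy_grad_phi :
  ((m%:R / 32)%:E <= energy (fun x => enorm x * enorm (grad_phi L x))%R)%E.
Proof.
have l0 := l_gt0; have L0 : 0 < L by rewrite exprn_gt0.
pose h i : R := 2^-1 ^+ i.+1.
have h0 i : 0 < h i by rewrite exprn_gt0// invr_gt0.
have hS i : h i.+1 = h i / 2 by rewrite /h exprS mulrC.
have h2 i : h i <= 2^-1.
  by rewrite /h exprS ger_pMr ?invr_gt0// exprn_ile1 ?invr_ge0// invf_le1// ler1n.
have hle i j : (i <= j)%N -> h j <= h i.
  by move=> ij; apply: ler_wiXn2l; rewrite ?invr_ge0// ?invf_le1 ?ler1n.
pose Q i : set plane := `]h i.+1, h i] `*` `]h i.+1, h i].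
have mQ i : measurable (Q i) by apply: measurableX; exact: measurable_itv.
have Qs i x : Q i x -> h i ^+ 2 / 2 <= dot x x <= 2 * h i ^+ 2.
  case: x => x1 x2 [/=]; rewrite !in_itv/= hS => /andP[a1 a2] /andP[b1 b2].
  have := h0 i; rewrite /dot/= !expr2; move: (h i) a1 a2 b1 b2 => y *.
  by apply/andP; split; nra.
have hh i : h i ^+ 2 <= 4^-1.
  by have := h0 i; have := h2 i; rewrite expr2; nra.
have Qd i : Q i `<=` disk.
  by move=> x /Qs /andP[_ xs]; apply/diskE; have := hh i; lra.
have tQ : trivIset setT Q.
  apply/trivIsetP => i j _ _.
  (* The abscissae of distinct squares lie in disjoint intervals. *)
  wlog ij : i j / (i < j)%N.
    by move=> H; rewrite neq_ltn => /orP[] ij; [|rewrite setIC]; apply: H => //; rewrite ?ltn_eqF ?gtn_eqF.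
  move=> _; rewrite -subset0 => -[x1 x2] [[/= + _] [/= + _]].
  rewrite !in_itv/= => /andP[a1 _] /andP[_ a2].
  by have := lt_le_trans a1 (le_trans a2 (hle _ _ ij)); rewrite ltxx.
pose c i : R := (8 * h i ^+ 2)^-1.
have mf : measurable_fun disk (fun x : plane => enorm (x : R * R) * enorm (grad_phi L x)).
  apply: measurable_funM; first exact: disk_enorm_measurable.
  exact: C1_measurable_enorm (C1_wente_phi L).
have := @energy_ge_boxes R (fun x => enorm x * enorm (grad_phi L x)) c Q m mf mQ Qd tQ.
have -> : (\sum_(i < m) (c i)%:E * leb2 (Q i) = (m%:R / 32)%:E)%E.
  rewrite (eq_bigr (fun=> (32^-1)%:E)).
    by rewrite sumEFin big_const_ord iter_addr_0 mulr_natl.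
  move=> i _; rewrite leb2_box; [|exact: hle..].
  rewrite -EFinM hS /c; congr EFin; field; rewrite gt_eqF//.
apply; first by move=> i; rewrite invr_ge0 mulr_ge0// sqr_ge0.
move=> i x im Qx; have /andP[s1 s2] := Qs i x Qx.
have p0 : 0 < h i ^+ 2 by rewrite exprn_gt0.
have sp : 0 < dot x x by lra.
have lh : 4 <= L * h i ^+ 2.
  have : 2 <= l * h i.
    rewrite /l /h exprVn ler_pdivlMr ?exprn_gt0// -exprS.
    by apply: ler_weXn2l; rewrite ?ler1n.
  by rewrite /L -exprMn expr2; nra.
have S1 : 1 <= L * dot x x by nra.
have [gE g1E _] := profile_ge1 S1.
rewrite exprMn !sqr_enorm.
have -> : dot x x * dot (grad_phi L x) (grad_phi L x) =
   (1 - dot x x) ^+ 2 / dot x x + 4 * x.1 ^+ 2 / dot x x.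
  rewrite /grad_phi /amplitude gE g1E.
  set s := dot x x in sp *.
  have sE : x.2 ^+ 2 = s - x.1 ^+ 2 by rewrite /s /dot; ring.
  rewrite /dot /=.
  transitivity (s * ((s^-1 - 1 - 2 * x.1 ^+ 2 / s ^+ 2) ^+ 2 +
     (2 / s ^+ 2) ^+ 2 * (x.1 ^+ 2 * x.2 ^+ 2))).
    by field; rewrite !gt_eqF.
  by rewrite sE; field; rewrite gt_eqF.
apply: (@le_trans _ _ ((1 - dot x x) ^+ 2 / dot x x)).
  have p8 : 0 < 8 * h i ^+ 2 by rewrite mulr_gt0.
  rewrite /c ler_pdivlMr// -(ler_pM2l p8) mulrA mulfV ?gt_eqF// mul1r.
  have := hh i; move: (h i ^+ 2) (dot x x) p0 s1 s2 sp => y s y0 ys sy s0 y4.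
  have q : 4^-1 <= (1 - s) ^+ 2 by rewrite expr2; nra.
  by nra.
by rewrite lerDl divr_ge0 ?(ltW sp)// mulr_ge0// sqr_ge0.
Qed.

Lemma expRhalf_le2 : expR (2^-1 : R) <= 2.
Proof.
have := expR_ge1Dx (- 2^-1 : R); have := expR_gt0 (2^-1 : R).
rewrite expRN; move: (expR _) => e e0 H.
rewrite -(ler_pM2r (_ : 0 < e^-1)) ?invr_gt0// mulfV ?gt_eqF//; lra.
Qed.

Lemma ln2_ge : 2^-1 <= ln 2 :> R.
Proof.
rewrite -(@expRK R 2^-1) ler_ln ?posrE ?expR_gt0//.
exact: expRhalf_le2.
Qed.

(** Let rho = 1/l = 2^-(m+1), n = m+1 and y = rho / r >= 1.  Then
    |ln r| = n ln 2 + ln y lies between 1 and n y, so |ln r|^beta is at most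
    (n y)^gamma with gamma = max(beta, 0) <= 2, hence at most n^gamma y^2, and
    r^2 y^2 = rho^2. *)
Lemma weight_bound (beta r : R) : (0 < m)%N -> beta < 1 -> 0 < r -> r <= l^-1 ->
  r ^+ 2 * `|ln r| `^ beta <= l^-1 ^+ 2 * m.+1%:R `^ (Num.max beta 0).
Proof.
move=> m0 b1 r0 rl; have l0 := l_gt0.
pose y := (l * r)^-1.
have y1 : 1 <= y.
  by rewrite /y invf_ge1 ?mulr_gt0// mulrC -ler_pdivlMr// div1r.
have y0 : 0 < y by lra.
have n2 : (2 : R) <= m.+1%:R by rewrite ler_nat.
have lnr : ln r = - (m.+1%:R * ln 2 + ln y).
  have -> : r = (l * y)^-1 by rewrite /y; field; rewrite !gt_eqF.
  by rewrite lnV ?posrE ?mulr_gt0// lnM ?posrE// /l lnXn// mulr_natl.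
have lny : ln y <= y - 1.
  by rewrite -{1}(subrK 1 y) addrC; apply: le_ln1Dx; lra.
have lny0 : 0 <= ln y by rewrite ln_ge0.
have l21 : ln 2 <= 1 :> R by have := @le_ln1Dx R 1; rewrite -[1 + 1]/(2 : R); apply; lra.
have l22 := ln2_ge.
have X1 : 1 <= `|ln r|.
  rewrite lnr normrN ger0_norm; last by nra.
  by nra.
have Xy : `|ln r| <= m.+1%:R * y.
  rewrite lnr normrN ger0_norm; last by nra.
  by nra.
set gam := Num.max beta 0.
have g0 : 0 <= gam by rewrite le_max lexx orbT.
have g2 : gam <= 2%:R by rewrite ge_max; apply/andP; split; lra.
apply: (@le_trans _ _ (r ^+ 2 * (m.+1%:R `^ gam * y ^+ 2))).
  apply: ler_wpM2l; first exact: sqr_ge0.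
  apply: (@le_trans _ _ (`|ln r| `^ gam)).
    by apply: ler_powR => //; rewrite le_max lexx.
  apply: (@le_trans _ _ ((m.+1%:R * y) `^ gam)).
    by apply: ge0_ler_powR; rewrite ?nnegrE//; nra.
  rewrite powRM//; last by lra.
  apply: ler_wpM2l; first exact: powR_ge0.
  by rewrite -powR_mulrn ?(ltW y0)//; exact: ler_powR.
rewrite le_eqVlt; apply/orP; left; apply/eqP.
by rewrite /y; field; rewrite !gt_eqF.
Qed.

Lemma log_weight_sqr (beta : R) (x : R * R) :
  log_weight beta x ^+ 2 = enorm x ^+ 2 * `|ln (enorm x)| `^ beta.
Proof.
rewrite /log_weight exprMn; congr (_ * _).
rewrite -powR_mulrn ?powR_ge0// -powRrM; congr (_ `^ _); lra.
Qed.

Lemma measurable_log_weight (beta : R) :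
  measurable_fun disk (fun x : plane => log_weight beta x).
Proof.
apply: measurable_funM; first exact: disk_enorm_measurable.
apply: (measurableT_comp (measurable_powR (beta / 2))).
apply: measurableT_comp; first exact: normr_measurable.
exact: (measurableT_comp (@measurable_ln R) disk_enorm_measurable).
Qed.

(** |grad b| is of order L on L |x|^2 <= 1, where the squared weight is at most
    (m+1)^max(beta, 0) / L; the area of that region is of order 1 / L. *)
Lemma energy_grad_b (beta C : R) (source1 : R -> R) : (0 < m)%N -> beta < 1 ->
  smooth1 source1 -> (forall t : R, is_derive t 1 source (source1 t)) -> 0 < C ->
  (forall t : R, 0 <= t <= 1 -> `|source t| <= C /\ `|source1 t| <= C) ->
  (forall t : R, 1 < t -> source t = 0 /\ source1 t = 0) ->
  (energy (fun x => log_weight beta x * enorm (grad_b L source1 x))%R <=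
     (40 * C ^+ 2 * m.+1%:R `^ (Num.max beta 0))%:E)%E.
Proof.
move=> m0 b1 smooth_source1 Dsource C0 kC kout; have l0 := l_gt0.
have L0 : 0 < L by rewrite exprn_gt0.
set W := _ `^ _; have W0 : 0 <= W by exact: powR_ge0.
have -> : 40 * C ^+ 2 * W = (10 * C ^+ 2 * L * W) * (2 * l^-1) ^+ 2.
  by rewrite /L; field; rewrite gt_eqF.
have S0 (x : R * R) : 0 <= L * dot x x by rewrite mulr_ge0 ?dot_ge0// ltW.
have Gb0 x : 1 < L * dot x x -> dot (grad_b L source1 x) (grad_b L source1 x) = 0.
  by move=> S1; have [k0 k'0] := kout _ S1; rewrite /grad_b k0 k'0 /dot/=; ring.
have GbC x : L * dot x x <= 1 -> dot (grad_b L source1 x) (grad_b L source1 x) <= 10 * C ^+ 2 * L ^+ 2.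
  move=> S1; have [] := kC (L * dot x x); first by rewrite S0.
  rewrite /grad_b; set K := source _; set K' := source1 _ => KC K'C.
  pose p := 2 * L * (x.1 * x.2); pose q := 2 * L * (x.2 * x.2).
  have -> : dot (- L * (K' * (2 * L * x.1)) * x.2, - L * (K' * (2 * L * x.2)) * x.2 - L * K)
     (- L * (K' * (2 * L * x.1)) * x.2, - L * (K' * (2 * L * x.2)) * x.2 - L * K) =
     L ^+ 2 * ((K' * p) ^+ 2 + (K' * q + K) ^+ 2).
    by rewrite /dot /p /q /=; ring.
  rewrite mulrC; apply: ler_wpM2r; first exact: sqr_ge0.
  have p1 : `|p| <= 1.
    have h1 := mulr_ge0 (ltW L0) (sqr_ge0 (x.1 - x.2)).
    have h2 := mulr_ge0 (ltW L0) (sqr_ge0 (x.1 + x.2)).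
    rewrite /dot in S1; rewrite ler_norml /p !expr2 in h1 h2 *.
    by apply/andP; split; lra.
  have q2 : `|q| <= 2.
    have h1 := mulr_ge0 (ltW L0) (sqr_ge0 x.1).
    have h2 := mulr_ge0 (ltW L0) (sqr_ge0 x.2).
    rewrite /dot in S1; rewrite ler_norml /q !expr2 in h1 h2 *.
    by apply/andP; split; lra.
  have a1 : `|K' * p| <= C.
    by rewrite normrM -[leRHS]mulr1; apply: ler_pM.
  have a2 : `|K' * q + K| <= 3 * C.
    apply: le_trans (ler_normD _ _) _; rewrite normrM.
    have : `|K'| * `|q| <= C * 2 by apply: ler_pM.
    lra.
  move: a1 a2; rewrite !ler_norml => /andP[? ?] /andP[? ?].
  have : (K' * p) ^+ 2 <= C ^+ 2 by rewrite !expr2; nra.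
  have : (K' * q + K) ^+ 2 <= 9 * C ^+ 2 by rewrite !expr2; nra.
  lra.
have Lr x : L * dot x x <= 1 -> enorm x <= l^-1.
  move=> S1; rewrite -(ler_pXn2r (ltn0Sn 1)) ?nnegrE ?sqrtr_ge0 ?invr_ge0 ?(ltW l0)//.
  by rewrite sqr_enorm exprVn -div1r ler_pdivlMr ?exprn_gt0// mulrC.
have mGb := C1_measurable_enorm (C1_wente_b L smooth_source1 Dsource).
apply: energy_le_box.
- apply: measurable_funM; [exact: measurable_log_weight|exact: mGb].
- by rewrite mulr_ge0// mulr_ge0// ?(ltW L0)// mulr_ge0// sqr_ge0.
- by rewrite invr_ge0 ltW.
- move=> x _; rewrite enorm_prod_sqr.
  have [S1|S1] := leP (L * dot x x) 1; last first.
    by rewrite Gb0// mulr0 mulr_ge0// mulr_ge0// ?(ltW L0)// mulr_ge0// sqr_ge0.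
  have w1 : log_weight beta x ^+ 2 <= l^-1 ^+ 2 * W.
    rewrite log_weight_sqr; have [->|x0] := eqVneq (enorm x) 0.
      by rewrite expr0n/= mul0r mulr_ge0// sqr_ge0.
    apply: weight_bound => //; last exact: Lr.
    by rewrite lt_neqAle eq_sym x0 sqrtr_ge0.
  have -> : 10 * C ^+ 2 * L * W = (l^-1 ^+ 2 * W) * (10 * C ^+ 2 * L ^+ 2).
    by rewrite /L; field; rewrite gt_eqF.
  by apply: ler_pM => //; [exact: sqr_ge0|exact: dot_ge0|exact: GbC].
- move=> x _ f0; apply: coord_le; first by rewrite invr_ge0 ltW.
  rewrite -sqr_enorm ler_pXn2r ?nnegrE ?sqrtr_ge0 ?invr_ge0 ?(ltW l0)//.
  apply: Lr; rewrite leNgt; apply: contra_neqN f0 => S1.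
  by apply/eqP; rewrite -sqrf_eq0 enorm_prod_sqr Gb0// mulr0.
Qed.

End Estimates.

(** * Unboundedness of the quotient *)

Section Conclusion.
Context {R : realType}.

(** Once n^(1 - gam) >= 2 B with n = m + 1, one has B n^gam <= n / 2 <= m. *)
Lemma sublinear_powR (gam B : R) : gam < 1 -> 0 <= B ->
  exists2 m : nat, (0 < m)%N & B * m.+1%:R `^ gam <= m%:R.
Proof.
move=> g1 B0; pose p := (1 - gam)^-1.
have g0 : 0 < 1 - gam by rewrite subr_gt0.
have [m [m1 mB]] : exists m : nat, (1 : R) <= m%:R /\ (2 * B) `^ p <= m%:R.
  near \oo => m; exists m; split; near: m; exact: nbhs_infty_ger.
exists m; first by rewrite -(ltr0n R); lra.
have n0 : (0 : R) < m.+1%:R by [].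
have n2 : (m.+1%:R : R) = m%:R + 1 by rewrite natr1.
have H : 2 * B <= m.+1%:R `^ (1 - gam).
  have -> : 2 * B = ((2 * B) `^ p) `^ (1 - gam).
    by rewrite -powRrM mulVf ?gt_eqF// powRr1 ?mulr_ge0.
  apply: ge0_ler_powR; rewrite ?nnegrE ?powR_ge0 ?(ltW g0) ?(ltW n0)//.
  by rewrite n2; lra.
have E : (m.+1%:R : R) = m.+1%:R `^ (1 - gam) * m.+1%:R `^ gam.
  by rewrite -powRD ?subrK ?powRr1 ?(ltW n0)//; apply/implyP => _; rewrite gt_eqF.
have W0 : 0 <= (m.+1%:R : R) `^ gam := powR_ge0 _ _.
move: E H W0; move: (_ `^ (1 - gam)) (_ `^ gam) => X W; rewrite n2 => E H W0.
by nra.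
Unshelve. all: by end_near. Qed.

Lemma L2norm_le (f : R * R -> R) (e : R) : (energy f <= e%:E)%E -> energy f != 0%E ->
  exists r : R, [/\ 0 < r, r ^+ 2 <= e & L2norm f = r%:E].
Proof.
rewrite L2norm_energy; have := energy_ge0 f.
case: (energy f) => [s|//|//]; rewrite !lee_fin eqe => s0 se sn0.
have sp : 0 < s by rewrite lt_neqAle eq_sym sn0.
by exists (Num.sqrt s); rewrite sqrtr_gt0 sqr_sqrtr.
Qed.

Lemma L2norm_ge (f : R * R -> R) (e : R) : L2 f -> (e%:E <= energy f)%E ->
  exists r : R, [/\ 0 <= r, e <= r ^+ 2 & L2norm f = r%:E].
Proof.
move=> [_]; rewrite L2norm_lty L2norm_energy; have := energy_ge0 f.
case: (energy f) => [s|//|//]; rewrite !lee_fin => s0 _ es.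
by exists (Num.sqrt s); rewrite sqrtr_ge0 sqr_sqrtr.
Qed.

Lemma enorm_neq0 (v : R * R) : 0 < dot v v -> enorm v != 0.
Proof. by move=> v0; rewrite gt_eqF// sqrtr_gt0. Qed.

(** Near the origin height1 = -1, so grad a = - 2 L x there. *)
Lemma energy_grad_a_neq0 (L : R) : 0 < L -> energy (fun x => 1 * enorm (grad_a L x))%R != 0%E.
Proof.
move=> L0; pose a := (4 * (1 + L))^-1.
have a0 : 0 < a by rewrite invr_gt0; lra.
(* On [a, 2a]^2 both |x|^2 < 1 and L |x|^2 <= 1 hold. *)
have aL : 4 * a * (1 + L) = 1 by rewrite /a; field; lra.
apply: (@energy_neq0 R _ a (2 * a)).
- under eq_fun do rewrite mul1r.
  exact: C1_measurable_enorm (C1_wente_a L).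
- by lra.
- move=> x1 x2 /andP[a1 a2] /andP[b1 b2].
  have s1 : dot (x1, x2) (x1, x2) <= 8 * (a * a) by rewrite /dot/=; nra.
  have s2 : 0 < dot (x1, x2) (x1, x2) by rewrite /dot/=; nra.
  have a4 : a <= 4^-1 by nra.
  split; first by apply/diskE; nra.
  rewrite mul1r; apply: enorm_neq0.
  rewrite /grad_a height1_le1; last by nra.
  rewrite (_ : dot _ _ = 4 * L ^+ 2 * dot (x1, x2) (x1, x2)).
    by rewrite mulr_gt0// mulr_gt0// exprn_gt0.
  by rewrite /dot/=; ring.
Qed.

(** At the origin the second component of grad b is - L source 0, which is
    nonzero, and it stays nonzero on a small square away from the zero of the
    weight. *)
Lemma energy_grad_b_neq0 (L beta : R) (source1 : R -> R) : 0 < L -> smooth1 source1 ->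
  (forall t : R, is_derive t 1 source (source1 t)) ->
  energy (fun x => log_weight beta x * enorm (grad_b L source1 x))%R != 0%E.
Proof.
move=> L0 smooth_source1 Dsource; have Cb := C1_wente_b L smooth_source1 Dsource.
have [_ _ _ _ cG] := Cb.
have G0 : (grad_b L source1 (0, 0)).2 != 0.
  have d0 : dot ((0, 0) : R * R) (0, 0) = 0 by rewrite /dot/=; ring.
  by rewrite /grad_b/= d0 !mulr0 sub0r oppr_eq0 mulf_neq0 ?source0_neq0// gt_eqF.
have : \forall x \near ((0, 0) : R * R), (grad_b L source1 x).2 != 0.
  exact: (cvgr_neq0 _ (cG (0, 0)) G0).
move=> /nbhs_ballP[e /= e0 He].
pose a := Num.min (e / 4) (8^-1).
have a0 : 0 < a by rewrite lt_min divr_gt0//= invr_gt0.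
have ae : a <= e / 4 by rewrite ge_min lexx.
have a8 : a <= 8^-1 by rewrite ge_min lexx orbT.
apply: (@energy_neq0 R _ a (2 * a)).
- apply: measurable_funM; first exact: measurable_log_weight.
  exact: C1_measurable_enorm Cb.
- by lra.
- move=> x1 x2 /andP[a1 a2] /andP[b1 b2].
  have s1 : dot (x1, x2) (x1, x2) < 1 by rewrite /dot/=; nra.
  have s2 : 0 < dot (x1, x2) (x1, x2) by rewrite /dot/=; nra.
  have xd : disk (x1, x2) by apply/diskE.
  split => //; apply: mulf_neq0.
    have e1 : 0 < enorm (x1, x2) by rewrite sqrtr_gt0.
    rewrite /log_weight mulf_neq0 ?gt_eqF// powR_gt0// normr_gt0 lt_eqF//.
    by apply: ln_lt0; rewrite e1.
  apply: enorm_neq0; rewrite lt_neqAle dot_ge0 andbT eq_sym.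
  have g0 : (grad_b L source1 (x1, x2)).2 != 0.
    by apply: He; split; rewrite /ball/= sub0r normrN ger0_norm; lra.
  by rewrite /dot -!expr2 paddr_eq0 ?sqr_ge0// !sqrf_eq0 (negbTE g0) andbF.
Qed.

End Conclusion.

Local Open Scope ereal_scope.

Theorem theorem2 (R : realType) (beta : R) (hbeta : (beta < 1)%R) :
  ereal_sup
    [set q : \bar R | exists (a b phi : R * R -> R) (Ga Gb Gphi : R * R -> R * R),
       let den := L2wnorm (cst 1%R) Ga * L2wnorm (log_weight beta) Gb in
       [/\ W12 a Ga, W12 b Gb,
           the_dirichlet_solution (jacobian_det Ga Gb) phi Gphi,
           den != 0 /\ den \is a fin_num
         & q = L2wnorm enorm Gphi / den]]
  = +oo.
Proof.
apply/eqyP => A A0.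
have [source1 [C [smooth_source1 Dsource C0 kC kout]]] := @source_derive R.
pose gam : R := Num.max beta 0%R.
have g1 : (gam < 1)%R by rewrite gt_max hbeta ltr01.
(* A^2 times the product of the two denominator bounds, over the constant 1/32
   of the numerator. *)
pose B : R := (A ^+ 2 * 128 * (40 * C ^+ 2) * 32)%R.
have B0 : (0 <= B)%R.
  have A2 := sqr_ge0 A; have C2 := sqr_ge0 C.
  by apply: mulr_ge0 => //; apply: mulr_ge0; apply: mulr_ge0.
have [m m0 mA] := sublinear_powR g1 B0.
pose L : R := ((2 ^+ m.+1) ^+ 2)%R.
have l2 : (2 <= (2 ^+ m.+1 : R))%R := l_ge2 m.
have L2' : (2 <= L)%R by rewrite /L expr2; nra.
have L0 : (0 < L)%R by lra.
have [ra [ra0 raE nA]] := L2norm_le (energy_grad_a m) (energy_grad_a_neq0 L0).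
have [rb [rb0 rbE nB]] := L2norm_le (energy_grad_b m0 hbeta smooth_source1 Dsource C0 kC kout)
  (energy_grad_b_neq0 beta L0 smooth_source1 Dsource).
have LP : L2 (fun x => enorm x * enorm (grad_phi L x))%R.
  apply: continuous_L2; apply: continuous_mulf; apply: continuous_enorm.
  - by move=> x; exact: cvg_fst.
  - by move=> x; exact: cvg_snd.
  - by have [] := C1_wente_phi L.
  - by have [] := C1_wente_phi L.
have [rp [rp0 rpE nP]] := L2norm_ge LP (energy_grad_phi m).
apply: (@le_trans _ _ ((rp / (ra * rb))%R%:E)).
  rewrite lee_fin ler_pdivlMr ?mulr_gt0//.
  rewrite -(@ler_pXn2r _ 2)// ?nnegrE ?mulr_ge0 ?(ltW A0) ?(ltW ra0) ?(ltW rb0)//.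
  apply: le_trans rpE; rewrite ler_pdivlMr//; apply: le_trans mA.
  rewrite !exprMn -/gam /B.
  rewrite (_ : (_ * 32 * _ = A ^+ 2 * (128 * (40 * C ^+ 2 * m.+1%:R `^ gam)) * 32)%R); last by ring.
  rewrite ler_wpM2r// ler_wpM2l ?sqr_ge0//.
  by apply: ler_pM => //; exact: sqr_ge0.
apply: ereal_sup_ubound.
exists (wente_a L), (wente_b L), (wente_phi L), (grad_a L), (grad_b L source1), (grad_phi L) => /=.
have denE : L2wnorm (cst 1%R) (grad_a L) * L2wnorm (log_weight beta) (grad_b L source1) = (ra * rb)%R%:E.
  by rewrite EFinM -nA -nB.
have rab : (0 < ra * rb)%R by rewrite mulr_gt0.
rewrite denE; split.
- exact/C1_W12/C1_wente_a.
- exact/C1_W12/C1_wente_b.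
- exact: wente_phi_dirichlet.
- by rewrite eqe gt_eqF.
- by rewrite inver gt_eqF// EFinM -nP.
Qed.
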